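(* There exists a Cantor set in $\mathbb{C}^3$ that has nontrivial rational hull and is the union of two disjoint polynomially convex Cantor sets.
   Context: A Cantor set is any space homeomorphic to the usual middle-thirds Cantor set. For a compact set $X\subset\mathbb{C}^N$, the polynomial hull is $\widehat X=\{z\in\mathbb{C}^N:|p(z)|\le\max_{x\in X}|p(x)|\text{ for all polynomials }p\}$ and the rational hull is $h_r(X)=\{z\in\mathbb{C}^N:p(z)\in p(X)\text{ for all polynomials }p\}$, where polynomials are in the complex coordinates. $X$ is polynomially convex if $\widehat X=X$; the rational hull of $X$ is nontrivial if $h_r(X)\setminus X\neq\emptyset$. *)

(* Defs.v *)
From HB Require Import structures.
From mathcomp Require Import all_boot all_order all_algebra.
From mathcomp Require Import all_classical all_reals ereal topology normedtype.
From mathcomp Require Import complex.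
(* Not imported: the notations of mpoly clash with those of
   MathComp-Analysis. *)
From mathcomp Require mpoly.

Set Implicit Arguments.
Unset Strict Implicit.
Unset Printing Implicit Defensive.

Import Order.TTheory GRing.Theory Num.Theory.
Import numFieldNormedType.Exports.

Local Open Scope classical_set_scope.
Local Open Scope ring_scope.

(* R[i] carries the topology of its modulus, with which 'rV[R[i]]_n inherits
   the usual topology of C^n. *)
HB.instance Definition _ (R : realType) :=
  NormedModule.copy R[i] (R[i] : numClosedFieldType)^o.

(* A and B are homeomorphic as subspaces of T and U. The homeomorphism and its
   inverse are total functions on the ambient spaces; their values outside A
   and B are irrelevant. *)
Definition homeomorphic_sets (T U : ptopologicalType) (A : set T) (B : set U) :
    Prop :=
  exists (f : T -> U) (g : U -> T),
    [/\ set_fun A B f /\ set_fun B A g,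
        {in A, cancel f g},
        {in B, cancel g f},
        {within A, continuous f} &
        {within B, continuous g}].

Fixpoint cantor_stage (R : realType) (n : nat) : set R :=
  if n is m.+1 then
    [set x / 3 | x in @cantor_stage R m] `|`
    [set (x + 2) / 3 | x in @cantor_stage R m]
  else `[0, 1].

Definition middle_thirds (R : realType) : set R :=
  \bigcap_n @cantor_stage R n.

Definition is_cantor_set (R : realType) (T : ptopologicalType) (X : set T) :
    Prop :=
  homeomorphic_sets X (@middle_thirds R).

Definition peval (R : realType) (n : nat) (p : mpoly.mpoly n R[i])
    (z : 'rV[R[i]]_n) : R[i] :=
  mpoly.meval (z ord0) p.

(* For X compact and nonempty the supremum is the maximum of |p| on X. *)
Definition polynomial_hull (R : realType) (n : nat) (X : set 'rV[R[i]]_n) :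
    set 'rV[R[i]]_n :=
  [set z | forall p : mpoly.mpoly n R[i],
    ((Normc.normc (peval p z))%:E <=
       ereal_sup [set (Normc.normc (peval p x))%:E | x in X])%E].

Definition polynomially_convex (R : realType) (n : nat)
    (X : set 'rV[R[i]]_n) : Prop :=
  polynomial_hull X = X.

Definition rational_hull (R : realType) (n : nat) (X : set 'rV[R[i]]_n) :
    set 'rV[R[i]]_n :=
  [set z | forall p : mpoly.mpoly n R[i], (peval p @` X) (peval p z)].

Definition nontrivial_rational_hull (R : realType) (n : nat)
    (X : set 'rV[R[i]]_n) : Prop :=
  rational_hull X `\` X !=set0.

(* Main.v *)
Require Import Defs.
From mathcomp Require Import all_boot all_order all_algebra.
From mathcomp Require Import all_classical all_reals ereal topology normedtype.
From mathcomp Require Import complex.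
From mathcomp Require mpoly.
From mathcomp Require Import sequences zify ring lra.
Import numFieldNormedType.Exports.
Import Order.TTheory GRing.Theory Num.Theory.

(** Let E be a totally disconnected compact set in the plane and let g map the
Riemann sphere to C^3, continuously, and holomorphically outside E. An idea of
Wermer shows that the rational hull of g(E) contains the image of the whole
sphere: if a polynomial p has no zero on g(E), the function p(g) is close to
nonzero constants on the boundaries of small disjoint discs that cover E, so by
the argument principle p(g) has no zero outside these discs.

Here E is the union of a self-similar Cantor set E0 and its translate by 1000.
The coordinates of g are the Cauchy transform of the uniform measure on E0, that
of its translate, and z times the first; they extend continuously across E
because E0 has dimension larger than 1. The value of g at infinity is
(0, 0, 1). It is a point of the rational hull outside g(E), since on either
part of E the transform of the other part is close to +- 1 / 1000.

On E0 the second coordinate is the transform of a distant measure, hence nearly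
an affine function of z. It therefore still separates by lines the two halves of
every piece of E0, as in the plane. Polynomials in this one coordinate
approximate the indicator functions of the pieces, hence all continuous
functions, and this makes g(E0) a polynomially convex Cantor set. The same
holds for the other part with the first coordinate. The third coordinate makes
the two images disjoint.

Points of E are represented by the binary sequences that code them. The
transforms are limits of their discrete versions, rational functions whose poles
are the centres of level m, taken along small circles around these centres
([limit_exists], with the estimate [resolvent_self]). For these rational
functions the argument principle is a count of the roots of polynomials in the
discs ([tracked_rational_hull], [rouche_disc]). Polynomial convexity rests on
[uclosure_glue], where the indicator of a half-plane is obtained by Newton's
iteration for square roots of 1. *)

Set Implicit Arguments.
Unset Strict Implicit.
Unset Printing Implicit Defensive.

Local Open Scope classical_set_scope.
Local Open Scope ring_scope.

Local Notation nc := (@Normc.normc _).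
Local Notation Re := (@complex.Re _).
Local Notation Im := (@complex.Im _).

(** * The modulus of a complex number *)

Section Modulus.
Variable R : realType.
Implicit Types (z w : R[i]) (x y : R).

Lemma nc_sq z : nc z ^+ 2 = Re z ^+ 2 + Im z ^+ 2.
Proof. by case: z => x y /=; rewrite sqr_sqrtr // addr_ge0 ?sqr_ge0. Qed.

Lemma nc_ge0 z : 0 <= nc z.
Proof. by case: z => x y /=; rewrite sqrtr_ge0. Qed.

Lemma nc0 : nc (0 : R[i]) = 0.
Proof. exact: Normc.normc0. Qed.

Lemma nc1 : nc (1 : R[i]) = 1.
Proof. exact: Normc.normc1. Qed.

Lemma ncM z w : nc (z * w) = nc z * nc w.
Proof. exact: Normc.normcM. Qed.

Lemma ncV z : nc z^-1 = (nc z)^-1.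
Proof. exact: Normc.normcV. Qed.

Lemma ncN z : nc (- z) = nc z.
Proof. by case: z => x y /=; rewrite !sqrrN. Qed.

Lemma ncX z n : nc (z ^+ n) = nc z ^+ n.
Proof. by elim: n => [|n IH]; rewrite ?expr0 ?nc1 // !exprS ncM IH. Qed.

Lemma ncD z w : nc (z + w) <= nc z + nc w.
Proof. exact: le_normcD. Qed.

Lemma nc_distC z w : nc (z - w) = nc (w - z).
Proof. by rewrite -opprB ncN. Qed.

Lemma ncB z w : nc (z - w) <= nc z + nc w.
Proof. by rewrite -(ncN w) ncD. Qed.

Lemma nc_sub z w : nc z - nc w <= nc (z - w).
Proof. by have := ncD (z - w) w; rewrite subrK lerBlDr. Qed.

Lemma nc_add z w : nc z - nc w <= nc (z + w).
Proof. by have := nc_sub z (- w); rewrite opprK ncN. Qed.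

Lemma nc_triangle u z w : nc (z - w) <= nc (z - u) + nc (u - w).
Proof. by have := ncD (z - u) (u - w); rewrite addrA subrK. Qed.

Lemma nc_eq0 z : (nc z == 0) = (z == 0).
Proof.
by apply/eqP/eqP => [/Normc.eq0_normc|->]; rewrite ?nc0.
Qed.

Lemma nc_gt0 z : (0 < nc z) = (z != 0).
Proof. by rewrite lt0r nc_ge0 andbT nc_eq0. Qed.

Lemma nc_real x : nc x%:C%C = `|x|.
Proof. by rewrite /= expr0n /= addr0 sqrtr_sqr. Qed.

Lemma nc_nat n : nc (n%:R : R[i]) = n%:R.
Proof.
by rewrite -(rmorph_nat (real_complex R)) nc_real ger0_norm ?ler0n.
Qed.

Lemma Re_le_nc z : `|Re z| <= nc z.
Proof.
rewrite -(@ler_pXn2r _ 2) ?nnegrE ?nc_ge0 // nc_sq -normrX ger0_norm ?sqr_ge0 //.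
by rewrite lerDl sqr_ge0.
Qed.

Lemma Im_le_nc z : `|Im z| <= nc z.
Proof.
rewrite -(@ler_pXn2r _ 2) ?nnegrE ?nc_ge0 // nc_sq -normrX ger0_norm ?sqr_ge0 //.
by rewrite lerDr sqr_ge0.
Qed.

Lemma nc_le_ReIm z : nc z <= `|Re z| + `|Im z|.
Proof.
rewrite -(@ler_pXn2r _ 2) ?nnegrE ?nc_ge0 ?addr_ge0 // nc_sq sqrrD.
rewrite !real_normK ?num_real // lerD2r lerDl.
by rewrite mulrn_wge0 // mulr_ge0.
Qed.

Lemma nc_conj z : nc z^*%C = nc z.
Proof. by case: z => x y /=; rewrite sqrrN. Qed.

Lemma mul_conj z : z * z^*%C = (nc z ^+ 2)%:C%C.
Proof.
by rewrite nc_sq; case: z => x y; apply/eqP; rewrite eq_complex /=;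
  apply/andP; split; apply/eqP; ring.
Qed.

Lemma ReD z w : Re (z + w) = Re z + Re w.
Proof. by case: z w => [? ?] [? ?]. Qed.
Lemma ImD z w : Im (z + w) = Im z + Im w.
Proof. by case: z w => [? ?] [? ?]. Qed.
Lemma ReN z : Re (- z) = - Re z.
Proof. by case: z. Qed.
Lemma ImN z : Im (- z) = - Im z.
Proof. by case: z. Qed.
Lemma ReB z w : Re (z - w) = Re z - Re w.
Proof. by rewrite ReD ReN. Qed.
Lemma ImB z w : Im (z - w) = Im z - Im w.
Proof. by rewrite ImD ImN. Qed.
Lemma ReM z w : Re (z * w) = Re z * Re w - Im z * Im w.
Proof. by case: z w => [? ?] [? ?]. Qed.
Lemma ImM z w : Im (z * w) = Re z * Im w + Im z * Re w.
Proof. by case: z w => [? ?] [? ?]. Qed.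
Lemma ReV z : Re z^-1 = Re z / (Re z ^+ 2 + Im z ^+ 2).
Proof. by case: z. Qed.
Lemma Re_real x : Re x%:C%C = x. Proof. by []. Qed.
Lemma Im_real x : Im x%:C%C = 0. Proof. by []. Qed.
Lemma ReMreal x z : Re (x%:C%C * z) = x * Re z.
Proof. by rewrite ReM Re_real Im_real mul0r subr0. Qed.

Lemma realC_eq0 x : (x%:C%C == 0 :> R[i]) = (x == 0).
Proof. by rewrite eq_complex /= eqxx andbT. Qed.

(** The limit is the supremum of the increasing sequence u n - E n, where E n is
the sum of the remaining steps; keeping the rate of convergence avoids any
further passage to the limit. *)
Lemma geometric_cauchy_real (u : nat -> R) (K q : R) :
    0 < q -> q < 1 -> (forall n, `|u n - u n.+1| <= K * q ^+ n) ->
  exists l, forall n, `|u n - l| <= K / (1 - q) * q ^+ n.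
Proof.
move=> q0 q1 hu; set E := fun n => K / (1 - q) * q ^+ n.
have q1' : 0 < 1 - q by rewrite subr_gt0.
have EE n : E n = K * q ^+ n + E n.+1.
  by rewrite /E exprS; field; rewrite gt_eqF.
have K0 : 0 <= K by have := hu 0; rewrite expr0 mulr1; apply: le_trans.
have E0 n : 0 <= E n by rewrite /E mulr_ge0 ?divr_ge0 ?exprn_ge0 // ltW.
have up n k : u (n + k)%N - E (n + k)%N >= u n - E n.
  elim: k => [|k IH]; first by rewrite addn0.
  rewrite addnS; apply: le_trans IH _.
  by have := hu (n + k)%N; rewrite ler_norml (EE (n + k)%N); lra.
have dn n k : u (n + k)%N + E (n + k)%N <= u n + E n.
  elim: k => [|k IH]; first by rewrite addn0.
  rewrite addnS; apply: le_trans IH.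
  by have := hu (n + k)%N; rewrite ler_norml (EE (n + k)%N); lra.
pose A : set R := [set x | exists n, x = u n - E n].
have ubA n : ubound A (u n + E n).
  move=> _ [m ->]; have [mn|/ltnW nm] := leqP m n.
    by have := up m (n - m)%N; rewrite subnKC //; have := E0 n; lra.
  by have := dn n (m - n)%N; rewrite subnKC //; have := E0 m; lra.
have supA : has_sup A by split; [exists (u 0 - E 0), 0 | exists (u 0 + E 0)].
exists (sup A) => n; rewrite ler_norml.
have h1 : sup A <= u n + E n by apply: ge_sup => //; case: supA.
have h2 : u n - E n <= sup A by apply: ub_le_sup; [case: supA | exists n].
by rewrite -/(E n); lra.
Qed.

Lemma geometric_cauchy (u : nat -> R[i]) (K q : R) :
    0 < q -> q < 1 -> (forall n, nc (u n - u n.+1) <= K * q ^+ n) ->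
  exists l, forall n, nc (u n - l) <= 2 * K / (1 - q) * q ^+ n.
Proof.
move=> q0 q1 hu.
have [|a ha] := @geometric_cauchy_real (fun n => Re (u n)) K q q0 q1.
  by move=> n; apply: le_trans (hu n); rewrite -ReB Re_le_nc.
have [|b hb] := @geometric_cauchy_real (fun n => Im (u n)) K q q0 q1.
  by move=> n; apply: le_trans (hu n); rewrite -ImB Im_le_nc.
exists (Complex a b) => n; apply: le_trans (nc_le_ReIm _) _.
rewrite ReB ImB /=; apply: le_trans (lerD (ha n) (hb n)) _.
by rewrite le_eqVlt; apply/orP; left; apply/eqP; ring.
Qed.

Lemma geometric_small (K q e : R) : 0 <= q -> q < 1 -> 0 < e ->
  exists m, forall n, (m <= n)%N -> K * q ^+ n <= e.
Proof.
move=> q0 q1 e0.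
have [->|K0] := eqVneq K 0; first by exists 0 => n _; rewrite mul0r ltW.
have eK : 0 < e / `|K| by rewrite divr_gt0 // normr_gt0.
have /cvgrPdist_lt /(_ _ eK) [m _ hm] : (fun n => q ^+ n) @ \oo --> (0 : R).
  by apply: cvg_expr; rewrite ger0_norm.
exists m => n mn; have := hm n mn; rewrite /= sub0r normrN => h.
apply: le_trans (ler_norm _) _; rewrite normrM mulrC.
by rewrite -ler_pdivlMr ?normr_gt0 // ltW.
Qed.

End Modulus.

(** * Uniform limits and step functions *)

Section UniformClosure.
Variables (R : realType) (S : Type) (A : (S -> R[i]) -> Prop).

Definition bounded_algebra := [/\
  forall c, A (fun=> c),
  forall f g, A f -> A g -> A (fun s => f s + g s),
  forall f g, A f -> A g -> A (fun s => f s * g s) &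
  forall f, A f -> exists B, forall s, nc (f s) <= B].

(** The approximation takes place on D only, whereas members of A are bounded on
all of S: multiplied by something small, an approximant that is good on one
piece does no harm on the others. *)
Definition uclosure (D : S -> Prop) (f : S -> R[i]) :=
  forall e : R, 0 < e ->
    exists2 g, A g & forall s, D s -> nc (f s - g s) <= e.

Hypothesis algA : bounded_algebra.
Implicit Types (D : S -> Prop) (f g h : S -> R[i]) (e q : R).

Lemma uclosure_incl D f : A f -> uclosure D f.
Proof. by move=> Af e e0; exists f => // s _; rewrite subrr nc0 ltW. Qed.

Lemma uclosure_cst D c : uclosure D (fun=> c).
Proof. by apply: uclosure_incl; case: algA. Qed.

Lemma uclosure_lim D f :
  (forall e, 0 < e ->
     exists2 g, uclosure D g & forall s, D s -> nc (f s - g s) <= e) ->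
  uclosure D f.
Proof.
move=> H e e0; have e2 : 0 < e / 2 by lra.
have [g Cg fg] := H _ e2; have [k Ak gk] := Cg _ e2.
exists k => // s Ds; apply: le_trans (nc_triangle (g s) _ _) _.
by have := fg s Ds; have := gk s Ds; lra.
Qed.

Lemma uclosure_ext D f g : (forall s, D s -> f s = g s) ->
  uclosure D f -> uclosure D g.
Proof.
move=> fg Cf; apply: uclosure_lim => e e0; exists f => // s Ds.
by rewrite fg // subrr nc0 ltW.
Qed.

Lemma uclosureW D D' f : (forall s, D' s -> D s) ->
  uclosure D f -> uclosure D' f.
Proof.
by move=> DD Cf e e0; have [g Ag fg] := Cf e e0; exists g => // s /DD; apply: fg.
Qed.

Lemma uclosure_bounded D f : uclosure D f ->
  exists2 B, 0 < B & forall s, D s -> nc (f s) <= B.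
Proof.
move=> Cf; have [g Ag fg] := Cf 1 ltr01.
have [_ _ _ /(_ g Ag) [B hB]] := algA.
exists (`|B| + 1) => [|s Ds]; first by have := normr_ge0 B; lra.
have := nc_sub (f s) (g s); have := fg s Ds; have := hB s.
by have := ler_norm B; lra.
Qed.

Lemma uclosureD D f g : uclosure D f -> uclosure D g ->
  uclosure D (fun s => f s + g s).
Proof.
move=> Cf Cg e e0; have e2 : 0 < e / 2 by lra.
have [f' Af ff] := Cf _ e2; have [g' Ag gg] := Cg _ e2.
have [_ addA _ _] := algA; exists (fun s => f' s + g' s); first exact: addA.
move=> s Ds; rewrite opprD addrACA; apply: le_trans (ncD _ _) _.
by have := ff s Ds; have := gg s Ds; lra.
Qed.

Lemma uclosureM D f g : uclosure D f -> uclosure D g ->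
  uclosure D (fun s => f s * g s).
Proof.
move=> Cf Cg e e0.
have [B B0 fB] := uclosure_bounded Cf.
have [|g' Ag gg] := Cg (e / 2 / B); first by rewrite !divr_gt0.
have [C C0 gC] := uclosure_bounded (uclosure_incl D Ag).
have [|f' Af ff] := Cf (e / 2 / C); first by rewrite !divr_gt0.
have [_ _ mulA _] := algA; exists (fun s => f' s * g' s); first exact: mulA.
move=> s Ds.
have -> : f s * g s - f' s * g' s = f s * (g s - g' s) + (f s - f' s) * g' s.
  by ring.
apply: le_trans (ncD _ _) _; rewrite !ncM.
have h1 : nc (f s) * nc (g s - g' s) <= B * (e / 2 / B).
  by apply: ler_pM; rewrite ?nc_ge0 ?fB ?gg.
have h2 : nc (f s - f' s) * nc (g' s) <= e / 2 / C * C.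
  by apply: ler_pM; rewrite ?nc_ge0 ?gC ?ff.
rewrite (mulrC B) divfK ?gt_eqF // in h1; rewrite divfK ?gt_eqF // in h2.
by lra.
Qed.

Lemma uclosureX D f n : uclosure D f -> uclosure D (fun s => f s ^+ n).
Proof.
move=> Cf; elim: n => [|n IH].
  by apply: uclosure_ext (uclosure_cst D 1) => s _; rewrite expr0.
by apply: uclosure_ext (uclosureM Cf IH) => s _; rewrite exprS.
Qed.

Lemma uclosure_sum D (F : nat -> S -> R[i]) n :
  (forall k, uclosure D (F k)) -> uclosure D (fun s => \sum_(k < n) F k s).
Proof.
move=> CF; elim: n => [|n IH].
  by apply: uclosure_ext (uclosure_cst D 0) => s _; rewrite big_ord0.
by apply: uclosure_ext (uclosureD IH (CF n)) => s _; rewrite big_ord_recr.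
Qed.

(** The partial sums of the Neumann series are polynomials in v. *)
Lemma uclosure_geom D v q : q < 1 -> uclosure D v ->
  (forall s, D s -> nc (v s) <= q) -> uclosure D (fun s => (1 - v s)^-1).
Proof.
move=> q1 Cv vq; have [q0|q0] := ltP q 0.
  apply: uclosure_ext (uclosure_cst D 0) => s Ds.
  by exfalso; have := vq s Ds; have := nc_ge0 (v s); lra.
have q1' : 0 < 1 - q by rewrite subr_gt0.
apply: uclosure_lim => e e0.
have [m /(_ m (leqnn m)) hm] := geometric_small (1 - q)^-1 q0 q1 e0.
exists (fun s => \sum_(k < m) v s ^+ k).
  by apply: (@uclosure_sum D (fun k s => v s ^+ k)) => k; apply: uclosureX.
move=> s Ds.
have n1 : 1 - q <= nc (1 - v s) by have := nc_sub 1 (v s); rewrite nc1;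
  have := vq s Ds; lra.
have v1 : 1 - v s != 0 by rewrite -nc_gt0; lra.
have -> : (1 - v s)^-1 - \sum_(k < m) v s ^+ k = v s ^+ m / (1 - v s).
  apply: (mulIf v1); rewrite mulrBl mulVf // divfK //.
  have := subrXX 1 (v s) m; rewrite expr1n.
  under eq_bigr do rewrite expr1n mul1r.
  by rewrite [_ * (1 - v s)]mulrC => <-; ring.
rewrite ncM ncV ncX; apply: le_trans hm; rewrite mulrC.
apply: ler_pM; rewrite ?invr_ge0 ?exprn_ge0 ?nc_ge0 //.
  by rewrite lef_pV2 // posrE; lra.
by apply: lerXn2r; rewrite ?nnegrE ?nc_ge0 // vq.
Qed.

(** Inverses are stable under perturbation: 1 / (h + f) is 1 / h times the sum
of a geometric series in f / h. *)
Lemma uclosure_inv_near D h f q : q < 1 ->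
  (forall s, D s -> h s != 0) ->
  uclosure D (fun s => (h s)^-1) -> uclosure D f ->
  (forall s, D s -> nc (f s / h s) <= q) ->
  uclosure D (fun s => (h s + f s)^-1).
Proof.
move=> q1 h0 Ch Cf fh.
have CN : uclosure D (fun s => - (f s / h s)).
  apply: uclosure_ext (uclosureM (uclosure_cst D (-1)) (uclosureM Cf Ch)).
  by move=> s _; rewrite mulN1r.
have := uclosure_geom q1 CN; move=> /(_ _) H.
have {H} Cg : uclosure D (fun s => (1 - - (f s / h s))^-1).
  by apply: H => s Ds; rewrite ncN fh.
apply: uclosure_ext (uclosureM Ch Cg) => s Ds.
rewrite opprK -invfM; congr (_^-1).
by rewrite mulrDr mulr1 [_ * (_ / _)]mulrC divfK ?h0.
Qed.

(** This is Runge's pole pushing. The pole iy of 1 / (h - iy) starts so high on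
the imaginary axis that a Neumann series applies, and then descends to 0 by
steps of d / 2, at most half its distance to the values of h. *)
Lemma uclosure_inv D h (d : R) : 0 < d -> uclosure D h ->
  (forall s, D s -> d <= `|Re (h s)|) -> uclosure D (fun s => (h s)^-1).
Proof.
move=> d0 Ch hd; have [B B0 hB] := uclosure_bounded Ch.
pose iy (y : R) : R[i] := Complex 0 y.
have Reiy y s : Re (h s - iy y) = Re (h s) by rewrite ReB /= subr0.
have far n y : 2 * B - n%:R * (d / 2) <= `|y| ->
    uclosure D (fun s => (h s - iy y)^-1).
  elim: n y => [|n IH] y hy.
    rewrite mul0r subr0 in hy.
    have nciy : nc (iy y) = `|y| by rewrite /= expr0n /= add0r sqrtr_sqr.
    have iy0 : - iy y != 0 by rewrite oppr_eq0 -nc_gt0 nciy; lra.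
    have h12 : 2^-1 < 1 :> R by lra.
    have := @uclosure_inv_near D (fun=> - iy y) h 2^-1 h12 (fun _ _ => iy0)
      (uclosure_cst _ _) Ch.
    move=> H; apply: uclosure_ext (H _) => [s _|s Ds]; first by rewrite addrC.
    rewrite ncM ncV ncN nciy ler_pdivrMr; last by lra.
    by have := hB s Ds; lra.
  pose y' := if 0 <= y then y + d / 2 else y - d / 2.
  have ny' : `|y'| = `|y| + d / 2.
    rewrite /y'; case: (lerP 0 y) => y0.
      by rewrite !ger0_norm //; lra.
    by rewrite ltr0_norm ?(ltr0_norm y0); lra.
  have yy : `|y' - y| = d / 2.
    rewrite /y'; case: ifP => _.
      by rewrite addrAC subrr add0r ger0_norm //; lra.
    by rewrite addrAC subrr add0r normrN ger0_norm //; lra.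
  have Cy : uclosure D (fun s => (h s - iy y')^-1).
    by apply: IH; rewrite ny'; move: hy; rewrite -natr1; lra.
  have dy s : D s -> d <= nc (h s - iy y').
    by move=> Ds; apply: le_trans (hd s Ds) _; rewrite -(Reiy y') Re_le_nc.
  have h12 : 2^-1 < 1 :> R by lra.
  have := @uclosure_inv_near D _ (fun=> iy (y' - y)) 2^-1 h12 _ Cy
      (uclosure_cst _ _).
  move=> H; apply: uclosure_ext (H _ _) => [s _|s Ds|s Ds].
  - congr (_^-1); rewrite -addrA; congr (_ + _).
    by apply/eqP; rewrite eq_complex /=; apply/andP; split; apply/eqP; ring.
  - by rewrite -nc_gt0; have := dy s Ds; lra.
  - have := dy s Ds => ds.
    rewrite ncM ncV {1}/iy /= expr0n /= add0r sqrtr_sqr yy ler_pdivrMr; last by lra.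
    by lra.
have [n hn] : exists n : nat, 2 * B - n%:R * (d / 2) <= 0.
  exists (Num.truncn (4 * B / d)).+1.
  have := truncnS_gt (4 * B / d); rewrite ltr_pdivrMr //; lra.
have := far n 0; rewrite normr0 => /(_ hn); apply: uclosure_ext => s _.
by rewrite [iy 0](_ : _ = 0) // subr0.
Qed.

(** The step of Newton's method for z ^ 2 = 1: it uses only ring operations and
the inverse, and tends to the sign of the real part. *)
Definition newton_sqrt1 (z : R[i]) : R[i] := (z + z^-1) / 2.

Lemma newton_sqrt1N z : newton_sqrt1 (- z) = - newton_sqrt1 z.
Proof. by rewrite /newton_sqrt1 invrN -opprD mulNr. Qed.

Lemma iter_newton_sqrt1N k z :
  iter k newton_sqrt1 (- z) = - iter k newton_sqrt1 z.
Proof. by elim: k => //= k ->; rewrite newton_sqrt1N. Qed.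

(** The coordinate (z - 1) / (z + 1) conjugates the Newton step to squaring. *)
Lemma iter_newton_sqrt1 k (z : R[i]) : z + 1 != 0 ->
    nc ((z - 1) / (z + 1)) < 1 ->
  let V := ((z - 1) / (z + 1)) ^+ (2 ^ k) in
  iter k newton_sqrt1 z = (1 + V) / (1 - V) /\ nc V < 1.
Proof.
move=> z1; set v := (z - 1) / (z + 1) => v1.
elim: k => [|k [IH V1]] /=.
  split; last by rewrite expn0 expr1.
  have two : (2 : R[i]) != 0 by rewrite pnatr_eq0.
  rewrite expn0 expr1 /v.
  have -> : 1 + (z - 1) / (z + 1) = 2 * z / (z + 1) by field.
  have -> : 1 - (z - 1) / (z + 1) = 2 / (z + 1) by field.
  field; rewrite ?z1 ?two //.
rewrite expnS mulnC exprM; set W := v ^+ (2 ^ k).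
have WV : nc (W ^+ 2) < 1.
  by rewrite ncX expr2; apply: le_lt_trans (V1); rewrite ler_piMl ?nc_ge0 // ltW.
split=> //; rewrite IH -/W /newton_sqrt1.
have Wm : 1 - W != 0.
  by rewrite -nc_gt0; have := nc_sub 1 W; rewrite nc1; move: V1; rewrite -/W; lra.
have Wp : 1 + W != 0.
  by rewrite -nc_gt0; have := nc_add 1 W; rewrite nc1; move: V1; rewrite -/W; lra.
have W2 : 1 - W ^+ 2 != 0.
  by rewrite -nc_gt0; have := nc_sub 1 (W ^+ 2); rewrite nc1; lra.
field; rewrite ?pnatr_eq0 ?Wm ?Wp ?W2 //.
Qed.

(** For Re z >= d the square of |(z - 1) / (z + 1)| is
1 - 4 Re z / |z + 1| ^ 2, which is at most t. *)
Lemma newton_sqrt1_cvg (d B t : R) (z : R[i]) k : 0 < d -> d <= B -> 1 <= B ->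
    d <= Re z -> nc z <= B -> t = 1 - 4 * d / (B + 1) ^+ 2 ->
  nc (iter k.+1 newton_sqrt1 z - 1) <= 2 / (1 - t) * t ^+ k.
Proof.
move=> d0 dB B1 dz zB tE.
have B2 : 0 < (B + 1) ^+ 2 by apply: exprn_gt0; lra.
have t1 : t < 1.
  rewrite tE; suff : 0 < 4 * d / (B + 1) ^+ 2 by lra.
  by rewrite divr_gt0 //; lra.
have t0 : 0 <= t.
  by rewrite tE subr_ge0 ler_pdivrMr // mul1r; nra.
have z1 : z + 1 != 0.
  by rewrite -nc_gt0; apply: lt_le_trans (Re_le_nc _); rewrite ReD /= normr_gt0; lra.
have z1B : nc (z + 1) ^+ 2 <= (B + 1) ^+ 2.
  apply: lerXn2r; rewrite ?nnegrE ?nc_ge0 //; first by lra.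
  by apply: le_trans (ncD _ _) _; rewrite nc1; lra.
have z1p : 0 < nc (z + 1) ^+ 2 by rewrite exprn_gt0 // nc_gt0.
pose v := (z - 1) / (z + 1).
have vt : nc v ^+ 2 <= t.
  rewrite ncM ncV exprMn exprVn ler_pdivrMr //.
  have -> : nc (z - 1) ^+ 2 = nc (z + 1) ^+ 2 - 4 * Re z.
    by rewrite !nc_sq ReB ImB ReD ImD /=; ring.
  rewrite tE mulrBl mul1r lerB // mulrAC ler_pdivrMr //.
  apply: ler_pM => //; [by lra | exact: ltW | by lra].
have v1 : nc v < 1.
  by rewrite -(@ltr_pXn2r _ 2) ?nnegrE ?nc_ge0 // expr1n; lra.
have [-> V1] := iter_newton_sqrt1 k.+1 z1 v1.
rewrite -/v; set V := v ^+ _.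
have Vt : nc V <= t ^+ (2 ^ k).
  rewrite /V expnS exprM -exprM mulnC exprM ncX ncX -exprM mulnC exprM.
  by apply: lerXn2r; rewrite ?nnegrE ?exprn_ge0 ?nc_ge0.
have tk : t ^+ (2 ^ k) <= t ^+ k.
  by rewrite ler_wiXn2l ?t0 ?(ltW t1) // ltnW // ltn_expl.
have tt : t ^+ (2 ^ k) <= t.
  by rewrite -{2}(expr1 t) ler_wiXn2l ?t0 ?(ltW t1) // expn_gt0.
have nV : 1 - t <= nc (1 - V) by have := nc_sub 1 V; rewrite nc1; lra.
have V1' : 1 - V != 0 by rewrite -nc_gt0; lra.
have -> : (1 + V) / (1 - V) - 1 = 2 / (1 - V) * V by field.
rewrite !ncM ncV nc_nat; apply: ler_pM; rewrite ?mulr_ge0 ?invr_ge0 ?nc_ge0 //.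
  by rewrite ler_wpM2l // lef_pV2 // posrE; lra.
exact: le_trans Vt tk.
Qed.

(** Each Newton step stays in the closure and at a positive distance from the
imaginary axis, and the convergence is uniform. *)
Lemma uclosure_sign D h (d : R) : 0 < d -> uclosure D h ->
  (forall s, D s -> d <= `|Re (h s)|) ->
  uclosure D (fun s => if 0 <= Re (h s) then 1 else -1).
Proof.
move=> d0 Ch hd.
have Citer k : uclosure D (fun s => iter k newton_sqrt1 (h s)) /\
    exists2 e, 0 < e & forall s, D s -> e <= `|Re (iter k newton_sqrt1 (h s))|.
  elim: k => [|k [IH [e e0 he]]]; first by split=> //; exists d.
  split.
    have Ci := uclosure_inv e0 IH he.
    exact: uclosure_ext (uclosureM (uclosureD IH Ci) (uclosure_cst D 2^-1)).
  exists (e / 2) => [|s Ds]; first by lra.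
  rewrite /= /newton_sqrt1; set z := iter k _ _.
  have e_z : e <= `|Re z| by apply: he.
  have z0 : 0 < Re z ^+ 2 + Im z ^+ 2.
    have zp : 0 < `|Re z| by lra.
    have : 0 < Re z ^+ 2 by rewrite -real_normK ?num_real // exprn_gt0.
    by have := sqr_ge0 (Im z); lra.
  have -> : Re ((z + z^-1) / 2) = Re z * ((1 + (Re z ^+ 2 + Im z ^+ 2)^-1) / 2).
    have half : (2 : R[i])^-1 = (2^-1)%:C%C by rewrite fmorphV rmorph_nat.
    rewrite half mulrC ReMreal ReD ReV.
    by field; rewrite gt_eqF.
  rewrite normrM; set c := (_ / 2).
  have c12 : 2^-1 <= c by rewrite /c; have := invr_gt0 (Re z ^+ 2 + Im z ^+ 2);
    rewrite z0 => ?; lra.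
  by rewrite (ger0_norm (le_trans _ c12)) ?invr_ge0 //; nra.
have [B0 B0p hB0] := uclosure_bounded Ch.
pose B := B0 + 1 + d; pose t := 1 - 4 * d / (B + 1) ^+ 2.
have B2 : 0 < (B + 1) ^+ 2 by apply: exprn_gt0; rewrite /B; lra.
have t1 : t < 1.
  rewrite /t; suff : 0 < 4 * d / (B + 1) ^+ 2 by lra.
  by rewrite divr_gt0 //; lra.
have t0 : 0 <= t.
  by rewrite /t subr_ge0 ler_pdivrMr // mul1r /B; nra.
apply: uclosure_lim => e e0.
have [m /(_ m (leqnn m)) hm] := geometric_small (2 / (1 - t)) t0 t1 e0.
exists (fun s => iter m.+1 newton_sqrt1 (h s)); first by case: (Citer m.+1).
move=> s Ds; have hs := hd s Ds; apply: le_trans hm.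
have hB := hB0 s Ds; have tE : t = 1 - 4 * d / (B + 1) ^+ 2 by [].
have dB : d <= B by rewrite /B; lra.
have B1 : 1 <= B by rewrite /B; lra.
have [r0|r0] := leP 0 (Re (h s)).
  rewrite nc_distC; apply: (newton_sqrt1_cvg _ d0 dB B1 _ _ tE).
    by rewrite -(ger0_norm r0).
  by rewrite /B; lra.
rewrite -[h s]opprK iter_newton_sqrt1N opprK addrC.
apply: (newton_sqrt1_cvg _ d0 dB B1 _ _ tE).
  by rewrite ReN -(ltr0_norm r0).
by rewrite ncN /B; lra.
Qed.

(** A line separating the images of the two pieces provides, through the sign
function, their indicator functions; f is then f1 on one piece and f0 on the
other up to a small error. *)
Lemma uclosure_glue D D1 D0 h f (c d : R) : 0 < d -> uclosure D h ->
    (forall s, D s -> D1 s \/ D0 s) ->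
    (forall s, D1 s -> c + d <= Re (h s)) ->
    (forall s, D0 s -> Re (h s) <= c - d) ->
  uclosure D1 f -> uclosure D0 f -> uclosure D f.
Proof.
move=> d0 Ch DD h1 h0 C1 C0.
have Ck : uclosure D (fun s => h s - c%:C%C).
  by apply: uclosureD Ch (uclosure_cst D _).
have Rek s : Re (h s - c%:C%C) = Re (h s) - c by rewrite ReB.
have Csgn := @uclosure_sign D _ d d0 Ck.
have {}Csgn : uclosure D (fun s => if 0 <= Re (h s - c%:C%C) then 1 else -1).
  apply: Csgn => s Ds; rewrite Rek; case: (DD s Ds) => [/h1|/h0] hs.
    by rewrite ger0_norm; lra.
  by rewrite ler0_norm; lra.
apply: uclosure_lim => e e0.
have [f1 A1 ff1] := C1 e e0; have [f0 A0 ff0] := C0 e e0.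
have two : (2 : R[i]) != 0 by rewrite pnatr_eq0.
pose sg s : R[i] := if 0 <= Re (h s - c%:C%C) then 1 else -1.
exists (fun s => (1 + sg s) * 2^-1 * f1 s + (1 + -1 * sg s) * 2^-1 * f0 s).
  have cst := uclosure_cst D; have inA f' := @uclosure_incl D f'.
  apply: uclosureD; apply: uclosureM; try exact: inA; apply: uclosureM => //.
    by apply: uclosureD.
  by apply: uclosureD => //; apply: uclosureM.
move=> s Ds; case: (DD s Ds) => Ds'.
  rewrite /sg Rek ifT; last by have := h1 s Ds'; lra.
  have -> : (1 + 1) * 2^-1 * f1 s + (1 + -1 * 1) * 2^-1 * f0 s = f1 s by field.
  exact: ff1.
rewrite /sg Rek ifF; last by have := h0 s Ds'; lra.
have -> : (1 + -1) * 2^-1 * f1 s + (1 + -1 * -1) * 2^-1 * f0 s = f0 s by field.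
exact: ff0.
Qed.

End UniformClosure.

(** * Zeros in a disc *)

Section Rouche.
Variable R : realType.
Implicit Types (z c : R[i]) (Q G : {poly R[i]}).

(** Averaging Q over z and - z leaves a polynomial in z ^ 2 of half the size,
with the same value at 0; every point of the circle is such a square. *)
Lemma Re_circle_mean Q (e : R) :
  (forall z, nc z = 1 -> e <= Re Q.[z]) -> e <= Re Q.[0].
Proof.
have [n] := ubnP (size Q); elim: n Q => // n IH Q sQ hQ.
have [s1|s1] := leqP (size Q) 1.
  by have := hQ 1 (nc1 R); rewrite (size1_polyC s1) !hornerC.
have hE z : Q.[z] + Q.[- z] = 2 * (even_poly Q).[z ^+ 2].
  have HQ w : Q.[w] = (even_poly Q).[w ^+ 2] + (odd_poly Q).[w ^+ 2] * w.
    by rewrite -{1}(poly_even_odd Q) hornerD hornerM !horner_comp hornerX hornerXn.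
  by rewrite (HQ z) (HQ (- z)) sqrrN; ring.
have Re2 z : Re (2 * z) = 2 * Re z.
  by rewrite -(rmorph_nat (real_complex R)) ReMreal.
have -> : Q.[0] = (even_poly Q).[0].
  have two : (2 : R[i]) != 0 by rewrite pnatr_eq0.
  have z2 : (0 : R[i]) ^+ 2 = 0 by rewrite expr0n.
  by apply: (mulfI two); have := hE 0; rewrite z2 oppr0 => <-; ring.
apply: IH => [|w w1].
  apply: leq_ltn_trans (size_even_poly _) _.
  case: (size Q) s1 sQ => [|[|k]] // _; rewrite ltnS; apply: leq_trans.
  by rewrite /= !ltnS leq_uphalf_double -addnn leq_addr.
pose z := sqrtC w; have zw : z ^+ 2 = w by rewrite sqrtCK.
have z1 : nc z = 1.
  apply/eqP; rewrite -(@pexpr_eq1 _ _ 2) ?nc_ge0 // -ncX.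
  by rewrite zw w1.
have := hQ z z1; have := hQ (- z); rewrite ncN z1 => /(_ erefl).
have := congr1 Re (hE z); rewrite ReD Re2 zw; lra.
Qed.

Definition polyfun_disc (f : {z : R[i] | nc z <= 1} -> R[i]) :=
  exists Q, forall s, f s = Q.[sval s].

Lemma polyfun_disc_algebra : bounded_algebra polyfun_disc.
Proof.
split=> [c|f g [P fP] [Q gQ]|f g [P fP] [Q gQ]|f [Q fQ]].
- by exists c%:P => s; rewrite hornerC.
- by exists (P + Q) => s; rewrite hornerD fP gQ.
- by exists (P * Q) => s; rewrite hornerM fP gQ.
suff [B hB] : exists B, forall z, nc z <= 1 -> nc Q.[z] <= B.
  by exists B => s; rewrite fQ; apply: hB; case: s.
elim/poly_ind: Q {fQ} => [|Q c [B hB]].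
  by exists 0 => z _; rewrite horner0 nc0.
exists (B + nc c) => z z1; rewrite !hornerE; apply: le_trans (ncD _ _) _.
rewrite lerD2r ncM; apply: le_trans (hB z z1).
by rewrite ler_piMr ?nc_ge0.
Qed.

(** The poles o lie outside the disc, where 1 / (z - o) is a geometric series, so
the fraction is a uniform limit of polynomials on the disc. *)
Lemma Re_circle_mean_fraction Q (os : seq R[i]) (e : R) :
    all (fun o => 1 < nc o) os ->
    (forall z, nc z = 1 -> e <= Re (Q.[z] / \prod_(o <- os) (z - o))) ->
  e <= Re (Q.[0] / \prod_(o <- os) (0 - o)).
Proof.
move=> os1 hQ; have algP := polyfun_disc_algebra.
pose f (s : {z : R[i] | nc z <= 1}) :=
  Q.[sval s] * (\prod_(o <- os) (sval s - o))^-1.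
have Cf : uclosure polyfun_disc (fun=> True) f.
  apply: uclosureM => //; first by apply: uclosure_incl; exists Q.
  elim: os os1 {hQ f} => [|o os IH] /=.
    move=> _; apply: uclosure_ext (uclosure_cst algP _ 1) => // s _.
    by rewrite big_nil invr1.
  move=> /andP[o1 /IH C]; apply: uclosure_ext (uclosureM algP _ C) => //.
    by move=> s _; rewrite big_cons [in RHS]invfM; reflexivity.
  have o0 : o != 0 by rewrite -nc_gt0; lra.
  have Cv : uclosure polyfun_disc (fun=> True)
      (fun s : {z : R[i] | nc z <= 1} => sval s / o).
    apply: uclosure_incl; exists ('X * (o^-1)%:P) => s.
    by rewrite hornerM hornerX hornerC.
  have q1 : (nc o)^-1 < 1 by rewrite invf_lt1 //; lra.
  have := uclosure_geom algP q1 Cv; move=> /(_ _) Cg.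
  apply: uclosure_ext (uclosureM algP (uclosure_cst algP _ (- o^-1)) (Cg _)) => //.
    move=> [z z1] _ /=; have zo : z - o != 0.
      by rewrite -nc_gt0 nc_distC; have := nc_sub o z; lra.
    have oz : o - z != 0 by rewrite -oppr_eq0 opprB.
    by field; rewrite o0 zo oz.
  by move=> [z z1] _ /=; rewrite ncM ncV ler_piMl // invr_ge0 nc_ge0.
rewrite leNgt; apply/negP => lt_e.
pose a := (e - Re (Q.[0] / \prod_(o <- os) (0 - o))) / 4.
have a0 : 0 < a by rewrite /a; lra.
have [g [P gP] fg] := Cf a a0.
have hP z : nc z <= 1 -> nc (Q.[z] / \prod_(o <- os) (z - o) - P.[z]) <= a.
  by move=> z1; have := fg (exist _ z z1) Logic.I; rewrite gP.
have hRe z : nc z <= 1 ->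
    `|Re (Q.[z] / \prod_(o <- os) (z - o)) - Re P.[z]| <= a.
  by move=> /hP; apply: le_trans; rewrite -ReB Re_le_nc.
have : e - a <= Re P.[0].
  apply: Re_circle_mean => z z1; have := hQ z z1.
  by have := hRe z; rewrite z1 ler_norml => /(_ (lexx _)); lra.
have := hRe 0; rewrite nc0 ler_norml => /(_ ler01).
by move: a0; rewrite /a; lra.
Qed.

(** If there were fewer zeros b inside than d, multiplying by the reflected
factors 1 - b^* z (on the circle z - b = z (1 - b^* z)^* ) would turn the
quotient of the two functions into a function with positive real part on the
circle, without poles in the disc, and vanishing at 0. *)
Lemma rouche_unit (k : R[i]) (bs os : seq R[i]) G d : k != 0 ->
    all (fun b => nc b < 1) bs -> all (fun o => 1 < nc o) os ->
    (forall z, nc z = 1 -> G.[z] != 0 /\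
      nc (k * \prod_(b <- bs) (z - b) * \prod_(o <- os) (z - o) - z ^+ d * G.[z])
        <= 2^-1 * nc (z ^+ d * G.[z])) ->
  (d <= size bs)%N.
Proof.
move=> k0 bs1 os1 H; rewrite leqNgt; apply/negP => dbs.
pose U : {poly R[i]} := \prod_(b <- bs) (1 - b^*%C *: 'X).
have UE z : U.[z] = \prod_(b <- bs) (1 - b^*%C * z).
  by rewrite horner_prod; apply: eq_bigr => b _; rewrite !hornerE.
have refl z : nc z = 1 ->
    \prod_(b <- bs) (z - b) * U.[z] = z ^+ size bs * (nc U.[z] ^+ 2)%:C%C.
  move=> z1; rewrite -mul_conj UE.
  have zz : z * z^*%C = 1 by rewrite mul_conj z1 expr1n.
  elim: (bs) => [|b s IH]; first by rewrite !big_nil expr0 rmorph1 !mul1r.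
  rewrite !big_cons /= exprS rmorphM /=.
  transitivity ((z - b) * (1 - b^*%C * z) *
     (\prod_(j <- s) (z - j) * \prod_(j <- s) (1 - j^*%C * z))); first by ring.
  rewrite IH rmorphB rmorph1 rmorphM /= conjcK.
  set V := \prod_(_ <- _) _.
  have -> : z - b = z * (1 - b * z^*%C).
    by rewrite mulrBr mulr1 mulrCA zz mulr1.
  by ring.
pose beta : R := \prod_(b <- bs) (1 - nc b).
have beta0 : 0 < beta.
  rewrite /beta big_seq; apply: prodr_gt0 => b bin.
  by have /allP /(_ b bin) := bs1; lra.
have betaU z : nc z = 1 -> beta <= nc U.[z].
  move=> z1; rewrite UE /beta; elim: (bs) bs1 => [|b s IH] /=.
    by rewrite !big_nil nc1.
  move=> /andP[b1 s1]; rewrite !big_cons ncM.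
  apply: ler_pM (IH s1); first by lra.
    rewrite big_seq; apply: prodr_ge0 => a ain.
    by have /allP /(_ a ain) := s1; lra.
  by have := nc_sub 1 (b^*%C * z); rewrite nc1 ncM nc_conj z1 mulr1.
pose Q := k^-1 *: ('X^(d - size bs) * G * U).
(* On the circle Q / M is |U| ^ 2 g / f, with g / f close to 1: the constant is
   Re (1 / w) >= (1 / 2) / (3 / 2) ^ 2 for |w - 1| <= 1 / 2. *)
have := @Re_circle_mean_fraction Q os (2 / 9 * beta ^+ 2) os1.
have -> : Q.[0] = 0.
  have z0 : (0 : R[i]) ^+ (d - size bs) = 0 by rewrite expr0n subn_eq0 leqNgt dbs.
  by rewrite hornerZ !hornerM hornerXn z0 !mul0r mulr0.
rewrite mul0r /= => /(_ _) C.
suff : 2 / 9 * beta ^+ 2 <= 0 by have := exprn_gt0 2 beta0; lra.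
apply: C => z z1; have [Gz] := H z z1.
set M := \prod_(o <- os) (z - o); set P := \prod_(b <- bs) (z - b) => HG.
have z0 : z != 0 by rewrite -nc_gt0 z1.
set g := z ^+ d * G.[z] in HG; set f := k * P * M in HG.
have g0 : 0 < nc g by rewrite nc_gt0 mulf_neq0 // expf_neq0.
have f0 : f != 0.
  rewrite -nc_gt0; have := nc_sub g f; rewrite nc_distC; lra.
have M0 : M != 0 by move: f0; rewrite /f mulf_eq0 negb_or => /andP[].
have -> : Q.[z] / M = (nc U.[z] ^+ 2)%:C%C * (g / f).
  rewrite /Q hornerZ !hornerM hornerXn; apply: (mulIf f0); rewrite -[in RHS]mulrA divfK //.
  rewrite /f /g.
  transitivity (z ^+ (d - size bs) * G.[z] * (P * U.[z])).
    by field; rewrite k0 M0.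
  by rewrite refl // -{2}(subnK (ltnW dbs)) exprD; ring.
rewrite ReMreal mulrC; apply: ler_pM; first by rewrite exprn_ge0 // ltW.
- by lra.
- by apply: lerXn2r; rewrite ?nnegrE ?nc_ge0 ?(ltW beta0) ?betaU.
pose w := f / g; have gn0 : g != 0 by rewrite -nc_gt0.
have w1 : nc (w - 1) <= 2^-1.
  have -> : w - 1 = (f - g) / g by rewrite /w mulrBl divff.
  by rewrite ncM ncV ler_pdivrMr.
have -> : g / f = w^-1 by rewrite /w invf_div.
rewrite ReV -nc_sq.
have wR : 2^-1 <= Re w.
  by have := le_trans (Re_le_nc _) w1; rewrite ReB ler_norml /=; lra.
have wn : nc w <= 3 / 2 by have := nc_sub w 1; rewrite nc1; lra.
have wp : 0 < nc w by have := Re_le_nc w; have := ler_norm (Re w); lra.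
rewrite ler_pdivlMr ?exprn_gt0 //; rewrite expr2; nra.
Qed.

(** The half of Rouche's theorem that bounds the number of zeros below: on the
circle the polynomial with roots rs is close to a function with a zero of
order d at the centre. *)
Lemma rouche_disc (k : R[i]) (rs : seq R[i]) G d c (r : R) : k != 0 -> 0 < r ->
    (forall z, nc (z - c) = r -> G.[z] != 0 /\
      nc (k * \prod_(a <- rs) (z - a) - (z - c) ^+ d * G.[z])
        <= 2^-1 * nc ((z - c) ^+ d * G.[z])) ->
  (d <= count (fun a : R[i] => (nc (a - c) < r)%R) rs)%N.
Proof.
move=> k0 r0 H; pose rC : R[i] := r%:C%C.
have rC0 : rC != 0 by rewrite realC_eq0 gt_eqF.
have nrC : nc rC = r by rewrite nc_real gtr0_norm.
pose inn (a : R[i]) := nc (a - c) < r.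
pose sc (a : R[i]) := (a - c) / rC.
have nsc (a : R[i]) : nc (sc a) = nc (a - c) / r by rewrite ncM ncV nrC.
have offc (a : R[i]) : a \in rs -> nc (a - c) != r.
  move=> ain; apply/eqP => ac; have [Gz] := H a ac.
  rewrite (_ : \prod_(j <- rs) _ = 0); last first.
    by apply/eqP; rewrite prodf_seq_eq0; apply/hasP; exists a; rewrite ?subrr ?eqxx.
  rewrite mulr0 sub0r ncN.
  have : 0 < nc ((a - c) ^+ d * G.[a]).
    by rewrite nc_gt0 mulf_neq0 // expf_neq0 // -nc_gt0 ac.
  by lra.
rewrite -size_filter -(size_map sc).
pose os := map sc (seq.filter (predC inn) rs).
pose G' := rC ^+ d *: (G \Po (rC *: 'X + c%:P)).
apply: (@rouche_unit (k * rC ^+ size rs) _ os G' d).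
- by rewrite mulf_neq0 // expf_neq0.
- apply/allP => _ /mapP[a + ->]; rewrite mem_filter => /andP[ai _].
  by rewrite nsc ltr_pdivrMr // mul1r.
- apply/allP => _ /mapP[a + ->]; rewrite mem_filter => /andP[ai ain].
  rewrite nsc ltr_pdivlMr // mul1r lt_neqAle eq_sym offc //.
  by move: ai; rewrite /= /inn -leNgt.
move=> w w1; pose z := rC * w + c.
have zc : z - c = rC * w by rewrite /z addrK.
have [Gz Hz] : G.[z] != 0 /\
      nc (k * \prod_(a <- rs) (z - a) - (z - c) ^+ d * G.[z])
        <= 2^-1 * nc ((z - c) ^+ d * G.[z]).
  by apply: H; rewrite zc ncM nrC w1 mulr1.
have zE : (rC *: 'X + c%:P).[w] = z by rewrite hornerD hornerZ hornerX hornerC.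
have GE : w ^+ d * G'.[w] = (z - c) ^+ d * G.[z].
  rewrite /G' hornerZ horner_comp zE zc exprMn; ring.
have PE : k * rC ^+ size rs * \prod_(b <- map sc (seq.filter inn rs)) (w - b)
    * \prod_(o <- os) (w - o) = k * \prod_(a <- rs) (z - a).
  rewrite -!mulrA; congr (_ * _); rewrite /os !big_map !big_filter.
  rewrite -(bigID inn xpredT (fun a => w - sc a)) /=.
  elim: (rs) => [|a s IH]; first by rewrite !big_nil mulr1.
  rewrite !big_cons -IH /= exprS.
  have -> : z - a = rC * (w - sc a).
    by rewrite mulrBr /sc mulrCA divff // mulr1 /z opprB addrA.
  by ring.
rewrite PE GE; split=> //.
rewrite /G' hornerZ horner_comp zE mulf_neq0 // expf_neq0 //.
Qed.

End Rouche.

(** * Functions on binary sequences *)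

Section CantorSpace.
Variable R : realType.
Implicit Types (s t : nat -> bool) (G : (nat -> bool) -> R[i]).

Definition agree m s t := forall i, (i < m)%N -> s i = t i.

(** Continuity on the compact space of binary sequences, in uniform form. *)
Definition ucont G := forall e : R, 0 < e ->
  exists m, forall s t, agree m s t -> nc (G s - G t) <= e.

Lemma agree_sym m s t : agree m s t -> agree m t s.
Proof. by move=> st i /st. Qed.

Lemma agree_trans m s t u : agree m s t -> agree m t u -> agree m s u.
Proof. by move=> st tu i im; rewrite st // tu. Qed.

Lemma agreeW m n s t : (m <= n)%N -> agree n s t -> agree m s t.
Proof. by move=> mn st i im; apply: st; apply: leq_trans mn. Qed.

Lemma agreeS m s t : agree m s t -> s m = t m -> agree m.+1 s t.
Proof.
by move=> st sm i; rewrite ltnS leq_eqVlt => /orP[/eqP ->//|/st].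
Qed.

(** Compactness, in the style of Koenig's lemma: if G has arbitrarily small values
on a cylinder, it has them on one of its two halves, and G would vanish at the
end of the branch found in this way. *)
Lemma ucont_bounded_below G : ucont G -> (forall s, G s != 0) ->
  exists2 e : R, 0 < e & forall s, e <= nc (G s).
Proof.
move=> cG G0; apply: contrapT => noe.
pose bad m s := forall e : R, 0 < e -> exists2 t, agree m s t & nc (G t) < e.
have bad0 : bad 0%N (fun=> false).
  move=> e e0; apply: contrapT => h; apply: noe; exists e => // s.
  by rewrite leNgt; apply/negP => Gs; apply: h; exists s.
have step m s : exists t, bad m s -> agree m s t /\ bad m.+1 t.
  pose u b := fun i => if (i < m)%N then s i else b.
  have au b : agree m s (u b) by move=> i im; rewrite /u im.
  have [b1|b1] := pselect (bad m.+1 (u true)); first by exists (u true).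
  have [b0|b0] := pselect (bad m.+1 (u false)); first by exists (u false).
  exists s => bs; exfalso.
  have out b : ~ bad m.+1 (u b) ->
      exists2 e, 0 < e & forall t, agree m.+1 (u b) t -> e <= nc (G t).
    move=> nb; apply: contrapT => h; apply: nb => e e0; apply: contrapT => h'.
    apply: h; exists e => // t ut; rewrite leNgt; apply/negP => Gt.
    by apply: h'; exists t.
  have [e1 e10 h1] := out _ b1; have [e0 e00 h0] := out _ b0.
  have [|t st Gt] := bs (Num.min e1 e0); first by rewrite lt_min e10.
  have umt : u (t m) m = t m by rewrite /u ltnn.
  have ut : agree m.+1 (u (t m)) t.
    by apply: agreeS umt; apply: agree_trans st; apply: agree_sym.
  move: Gt; rewrite lt_min; case: (t m) ut => [/h1|/h0]; lra.
have [f hf] := choice (fun ms : nat * (nat -> bool) => step ms.1 ms.2).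
pose br := fix br n := if n is m.+1 then f (m, br m) else (fun=> false).
have badbr n : bad n (br n).
  by elim: n => //= n IH; case: (hf (n, br n) IH).
have agbr n k : agree n (br n) (br (n + k)%N).
  elim: k => [|k IH]; first by rewrite addn0.
  apply: agree_trans IH _; rewrite addnS /=.
  by apply: agreeW (leq_addr k n) _; case: (hf ((n + k)%N, br (n + k)%N) (badbr _)).
pose s i := br i.+1 i.
have ags n : agree n (br n) s.
  move=> i lin; rewrite /s; have := agbr i.+1 (n - i.+1)%N i (leqnn _).
  by rewrite subnKC // => ->.
have Gs : 0 < nc (G s) / 2 by rewrite divr_gt0 // nc_gt0.
have [m hm] := cG _ Gs.
have [t bt Gt] := badbr m _ Gs.
have : nc (G s - G t) <= nc (G s) / 2.
  by apply: hm; apply: agree_trans bt; apply: agree_sym.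
have := nc_sub (G s) (G t); lra.
Qed.

End CantorSpace.

(** * Rational functions with given poles *)

Section Fractions.
Variable R : realType.
Implicit Types (D N : {poly R[i]}) (f g : R[i] -> R[i]) (v w : R[i]).

(** Off the zeros of D, f is the fraction N / D ^ d; the degree condition says that
f - v vanishes at infinity. *)
Definition fraction_at D f v := exists N d,
  (forall z, D.[z] != 0 -> f z * D.[z] ^+ d = N.[z]) /\
  (size (N - v *: D ^+ d)%R < size (D ^+ d)%R)%N.

Lemma size_mul_lt (A B D1 D2 : {poly R[i]}) : D1 \is monic -> D2 \is monic ->
  (size A < size D1)%N -> (size B <= size D2)%N ->
  (size (A * B)%R < size (D1 * D2)%R)%N.
Proof.
move=> m1 m2 sA sB; rewrite (@size_Mmonic _ D1) ?monic_neq0 //.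
have := size_polyMleq A B; move: sA sB.
have : (0 < size D2)%N by rewrite size_poly_gt0 monic_neq0.
move: (size A) (size B) (size D1) (size D2) (size (A * B)%R) => a b c e f; lia.
Qed.

Lemma fraction_at_ext D f g v : (forall z, D.[z] != 0 -> f z = g z) ->
  fraction_at D f v -> fraction_at D g v.
Proof. by move=> fg [N [d [h s]]]; exists N, d; split=> // z Dz; rewrite -fg // h. Qed.

Lemma fraction_at_cst D v : fraction_at D (fun=> v) v.
Proof.
exists v%:P, 0%N; split=> [z _|]; first by rewrite expr0 mulr1 hornerC.
by rewrite expr0 -mul_polyC mulr1 subrr size_poly0 size_poly1.
Qed.

Lemma fraction_atD D f g v w : D \is monic ->
  fraction_at D f v -> fraction_at D g w ->
  fraction_at D (fun z => f z + g z) (v + w).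
Proof.
move=> mD [N [d [hf sN]]] [M [e [hg sM]]].
exists (N * D ^+ e + M * D ^+ d), (d + e)%N; split.
  move=> z Dz; rewrite hornerD !hornerM !horner_exp -hf // -hg // exprD; ring.
have -> : N * D ^+ e + M * D ^+ d - (v + w) *: D ^+ (d + e) =
   (N - v *: D ^+ d) * D ^+ e + (M - w *: D ^+ e) * D ^+ d.
  by rewrite -!mul_polyC polyCD exprD; ring.
apply: leq_ltn_trans (size_polyD _ _) _.
rewrite gtn_max; apply/andP; split.
  by rewrite exprD size_mul_lt ?monic_exp.
by rewrite addnC exprD size_mul_lt ?monic_exp.
Qed.

Lemma fraction_atM D f g v w : D \is monic ->
  fraction_at D f v -> fraction_at D g w ->
  fraction_at D (fun z => f z * g z) (v * w).
Proof.
move=> mD [N [d [hf sN]]] [M [e [hg sM]]].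
exists (N * M), (d + e)%N; split.
  by move=> z Dz; rewrite hornerM -hf // -hg // exprD; ring.
have -> : N * M - (v * w) *: D ^+ (d + e) =
   (N - v *: D ^+ d) * M + (M - w *: D ^+ e) * (v *: D ^+ d).
  by rewrite -!mul_polyC polyCM exprD; ring.
have sM' : (size M <= size (D ^+ e)%R)%N.
  rewrite -(subrK (w *: D ^+ e) M).
  apply: leq_trans (size_polyD _ _) _; rewrite geq_max ltnW //.
  exact: size_scale_leq.
apply: leq_ltn_trans (size_polyD _ _) _.
rewrite gtn_max; apply/andP; split.
  by rewrite exprD size_mul_lt ?monic_exp.
by rewrite addnC exprD size_mul_lt ?monic_exp // size_scale_leq.
Qed.

Lemma fraction_at_inv (cs : seq R[i]) c : c \in cs ->
  fraction_at (\prod_(a <- cs) ('X - a%:P)) (fun z => (z - c)^-1) 0.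
Proof.
move=> cin; exists (\prod_(a <- rem c cs) ('X - a%:P)), 1%N.
rewrite expr1 scale0r subr0; split; last first.
  rewrite (perm_big _ (perm_to_rem cin)) !size_prod_XsubC /=.
  by rewrite size_rem // prednK //; case: (cs) cin.
move=> z; rewrite (perm_big _ (perm_to_rem cin)) big_cons hornerM hornerXsubC.
by rewrite mulf_eq0 negb_or => /andP[zc _]; rewrite expr1 mulKf.
Qed.

Lemma horner_prodXsub (cs : seq R[i]) z :
  (\prod_(a <- cs) ('X - a%:P)).[z] = \prod_(a <- cs) (z - a).
Proof. by rewrite horner_prod; apply: eq_bigr => a _; rewrite hornerXsubC. Qed.

(** On the sphere N / D ^ d has more poles in the discs than it has zeros, since
it vanishes at infinity; but near a nonzero constant on the boundary of a disc
it has as many zeros as poles inside. Here: by rouche_disc each of the disjoint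
discs contains d zeros of N, too many for its degree. *)
Lemma no_fraction_near_constants (cs : seq R[i]) (r : R) d N (k : R[i] -> R[i]) :
    uniq cs -> (0 < size cs)%N -> 0 < r ->
    (forall a b, a \in cs -> b \in cs -> a != b -> 2 * r < nc (a - b)) ->
    (size N <= d * size cs)%N ->
    (forall c, c \in cs -> k c != 0 /\ forall z, nc (z - c) = r ->
       nc (N.[z] - k c * \prod_(a <- cs) (z - a) ^+ d)
         <= 2^-1 * nc (k c * \prod_(a <- cs) (z - a) ^+ d)) ->
  False.
Proof.
move=> ucs cs0 r0 sep sN H; pose D z := \prod_(a <- cs) (z - a) ^+ d.
have offD c z : c \in cs -> nc (z - c) = r -> forall a, a \in cs -> z - a != 0.
  move=> cin zc a ain; have [ac|ac] := eqVneq a c.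
    by rewrite -nc_gt0 ac zc.
  rewrite -nc_gt0; have := sep a c ain cin ac.
  by have := nc_triangle z a c; rewrite (nc_distC a z) zc; lra.
have N0 : N != 0.
  have [c cin] : exists c, c \in cs.
    by case: (cs) cs0 => // c cs' _; exists c; rewrite mem_head.
  apply/eqP => N0; have [kc /(_ (c + r%:C%C))] := H c cin.
  have zc : nc (c + r%:C%C - c) = r by rewrite addrAC subrr add0r nc_real gtr0_norm.
  move=> /(_ zc); rewrite N0 horner0 sub0r ncN; apply/negP; rewrite -ltNge.
  suff : 0 < nc (k c * \prod_(a <- cs) (c + r%:C%C - a) ^+ d) by lra.
  rewrite nc_gt0 mulf_neq0 // prodf_seq_neq0; apply/allP => a ain.
  by rewrite expf_neq0 // (offD c).
have [rs Nrs] := closed_field_poly_normal N.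
have srs : size N = (size rs).+1.
  by rewrite {1}Nrs size_scale ?lead_coef_eq0 // size_prod_XsubC.
have Nz z : N.[z] = lead_coef N * \prod_(a <- rs) (z - a).
  by rewrite {1}Nrs hornerZ horner_prodXsub.
have dc c : c \in cs -> (d <= count (fun a : R[i] => (nc (a - c) < r)%R) rs)%N.
  move=> cin; have [kc Hc] := H c cin.
  pose G := k c *: \prod_(a <- rem c cs) ('X - a%:P) ^+ d.
  have GE z : (z - c) ^+ d * G.[z] = k c * D z.
    rewrite /D (perm_big _ (perm_to_rem cin)) big_cons hornerZ horner_prod mulrCA.
    congr (_ * (_ * _)); apply: eq_bigr => a _.
    by rewrite horner_exp hornerXsubC.
  apply: (@rouche_disc _ (lead_coef N) rs G d c r) => //.
    by rewrite lead_coef_eq0.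
  move=> z zc; rewrite GE -Nz; split; last exact: Hc.
  rewrite /G hornerZ horner_prod mulf_neq0 // prodf_seq_neq0; apply/allP => a ain.
  rewrite horner_exp hornerXsubC expf_neq0 //; apply: (offD c) => //.
  exact: mem_rem ain.
have cnt : (\sum_(c <- cs) count (fun a : R[i] => (nc (a - c) < r)%R) rs
    <= size rs)%N.
  elim: (rs) => [|a s IH] /=; first by rewrite big1.
  rewrite big_split /= -[(size s).+1]add1n leq_add //.
  have -> : (\sum_(c <- cs) (nc (a - c) < r)%R)%N =
      count (fun c => (nc (a - c) < r)%R) cs.
    by rewrite -sum1_count [in RHS]big_mkcond; apply: eq_bigr => c _; case: ifP.
  rewrite leqNgt -size_filter; apply/negP.
  have := filter_uniq (fun c => (nc (a - c) < r)%R) ucs.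
  have := mem_filter (fun c => (nc (a - c) < r)%R) ^~ cs.
  case: (seq.filter _ _) => [|x [|y l]] // mf /= /andP[xy _] _.
  have := mf x; rewrite mem_head => /esym/andP[xa xin].
  have := mf y; rewrite !inE eqxx orbT => /esym/andP[ya yin].
  move: xy; rewrite inE negb_or => /andP[/(sep x y xin yin) + _].
  by have := nc_triangle a x y; rewrite (nc_distC x a); lra.
have : (\sum_(c <- cs) d <= size rs)%N.
  apply: leq_trans cnt; rewrite big_seq [X in (_ <= X)%N]big_seq.
  by apply: leq_sum => c /dc.
rewrite big_const_seq count_predT iter_addn_0 => h.
by move: sN; rewrite srs ltnNge h.
Qed.

End Fractions.

(** * Points of the rational hull *)

Section UniformContinuity.
Variable R : realType.
Implicit Types (G H : (nat -> bool) -> R[i]).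

Lemma ucont_cst (c : R[i]) : ucont (fun=> c).
Proof. by move=> e e0; exists 0%N => s t _; rewrite subrr nc0 ltW. Qed.

Lemma ucontD G H : ucont G -> ucont H -> ucont (fun s => G s + H s).
Proof.
move=> cG cH e e0; have e2 : 0 < e / 2 by lra.
have [m hm] := cG _ e2; have [k hk] := cH _ e2.
exists (maxn m k) => s t st; rewrite opprD addrACA; apply: le_trans (ncD _ _) _.
have := hm s t (agreeW (leq_maxl _ _) st).
by have := hk s t (agreeW (leq_maxr _ _) st); lra.
Qed.

Lemma ucont_sum (I : Type) (r : seq I) (F : I -> (nat -> bool) -> R[i]) :
  (forall i, ucont (F i)) -> ucont (fun s => \sum_(i <- r) F i s).
Proof.
move=> cF; elim: r => [|i r IH].
  by under eq_fun do rewrite big_nil; apply: ucont_cst.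
by under eq_fun do rewrite big_cons; apply: ucontD.
Qed.

Lemma ucont_sqr_nc G (B : R) : ucont G -> (forall s, nc (G s) <= B) ->
  ucont (fun s => G s * (G s)^*%C).
Proof.
move=> cG GB e e0; have B0 : 0 <= B by apply: le_trans (GB (fun=> false)); rewrite nc_ge0.
have [|m hm] := cG (e / (2 * B + 1)); first by rewrite divr_gt0 //; lra.
exists m => s t /hm st.
have -> : G s * (G s)^*%C - G t * (G t)^*%C =
    G s * (G s - G t)^*%C + (G s - G t) * (G t)^*%C.
  by rewrite rmorphB; ring.
apply: le_trans (ncD _ _) _; rewrite !ncM !nc_conj.
have h1 : nc (G s) * nc (G s - G t) <= B * (e / (2 * B + 1)).
  by apply: ler_pM; rewrite ?nc_ge0.
have h2 : nc (G s - G t) * nc (G t) <= e / (2 * B + 1) * B.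
  by apply: ler_pM; rewrite ?nc_ge0.
apply: le_trans (lerD h1 h2) _.
have -> : B * (e / (2 * B + 1)) + e / (2 * B + 1) * B = (2 * B) / (2 * B + 1) * e.
  by field; lra.
rewrite ler_piMl ?(ltW e0) // ler_pdivrMr; lra.
Qed.

End UniformContinuity.

Section RationalHull.
Variables (R : realType) (n : nat).
Variables (cs : nat -> seq R[i]) (ctr : nat -> (nat -> bool) -> R[i]).
Variable rad : nat -> R.
Hypothesis rad_gt0 : forall m, 0 < rad m.
Hypothesis cs_uniq : forall m, uniq (cs m).
Hypothesis cs_gt0 : forall m, (0 < size (cs m))%N.
Hypothesis cs_sep : forall m a b, a \in cs m -> b \in cs m -> a != b ->
  2 * rad m < nc (a - b).
Hypothesis cs_ctr : forall m c, c \in cs m -> exists s, ctr m s = c.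
Hypothesis ctr_agree : forall m s t, agree m.+1 s t -> ctr m s = ctr m t.

(** G plays the role of the boundary values on a totally disconnected set of a
function that is holomorphic outside it: G is known through rational functions
U m with value v at infinity, whose poles are centres of level m and which are
close to G on the circles around these centres. The notion is stable under
ring operations, hence under polynomials. *)
Definition tracked (U : nat -> R[i] -> R[i]) (G : (nat -> bool) -> R[i]) v := [/\
  exists B, forall s, nc (G s) <= B,
  forall e : R, 0 < e -> exists m0, forall m, (m0 <= m)%N ->
    forall s z, nc (z - ctr m s) = rad m -> nc (U m z - G s) <= e &
  forall m, fraction_at (\prod_(a <- cs m) ('X - a%:P)) (U m) v].

Lemma tracked_ext U U' G G' v v' :
  (forall m z, U m z = U' m z) -> (forall s, G s = G' s) -> v = v' ->
  tracked U G v -> tracked U' G' v'.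
Proof.
move=> UE GE ->; have -> : U = U' by apply/funext => m; apply/funext => z.
by have -> : G = G' by apply/funext.
Qed.

Lemma tracked_cst (c : R[i]) : tracked (fun _ _ => c) (fun=> c) c.
Proof.
split; [by exists (nc c) | | by move=> m; apply: fraction_at_cst].
by move=> e e0; exists 0%N => m _ s z _; rewrite subrr nc0 ltW.
Qed.

Lemma trackedD U G v V H w : tracked U G v -> tracked V H w ->
  tracked (fun m z => U m z + V m z) (fun s => G s + H s) (v + w).
Proof.
move=> [[B GB] cU fU] [[C HC] cV fV]; split.
- exists (B + C) => s; apply: le_trans (ncD _ _) _.
  by have := GB s; have := HC s; lra.
- move=> e e0; have e2 : 0 < e / 2 by lra.
  have [m hm] := cU _ e2; have [k hk] := cV _ e2.
  exists (maxn m k) => l; rewrite geq_max => /andP[/hm {}hm /hk {}hk] s z zs.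
  rewrite opprD addrACA; apply: le_trans (ncD _ _) _.
  by have := hm s z zs; have := hk s z zs; lra.
by move=> m; apply: fraction_atD (fU m) (fV m); apply: monic_prod_XsubC.
Qed.

Lemma trackedM U G v V H w : tracked U G v -> tracked V H w ->
  tracked (fun m z => U m z * V m z) (fun s => G s * H s) (v * w).
Proof.
move=> [[B GB] cU fU] [[C HC] cV fV].
have B0 : 0 <= B by apply: le_trans (GB (fun=> false)); rewrite nc_ge0.
have C0 : 0 <= C by apply: le_trans (HC (fun=> false)); rewrite nc_ge0.
split.
- by exists (B * C) => s; rewrite ncM ler_pM ?nc_ge0.
- move=> e e0.
  have [|m hm] := cU (Num.min 1 (e / (2 * (C + 1)))).
    by rewrite lt_min ltr01 divr_gt0 //; lra.
  have [|k hk] := cV (Num.min 1 (e / (2 * (B + 1)))).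
    by rewrite lt_min ltr01 divr_gt0 //; lra.
  exists (maxn m k) => l; rewrite geq_max => /andP[/hm {}hm /hk {}hk] s z zs.
  have := hm s z zs; have := hk s z zs.
  rewrite !le_min => /andP[V1 Ve] /andP[U1 Ue].
  have -> : U l z * V l z - G s * H s = (U l z - G s) * V l z + G s * (V l z - H s).
    by ring.
  apply: le_trans (ncD _ _) _; rewrite !ncM.
  have h1 : nc (U l z - G s) * nc (V l z) <= e / (2 * (C + 1)) * (C + 1).
    apply: ler_pM; rewrite ?nc_ge0 //.
    by have := nc_sub (V l z) (H s); have := HC s; lra.
  have h2 : nc (G s) * nc (V l z - H s) <= (B + 1) * (e / (2 * (B + 1))).
    by apply: ler_pM; rewrite ?nc_ge0 //; have := GB s; lra.
  apply: le_trans (lerD h1 h2) _; rewrite le_eqVlt; apply/orP; left.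
  by apply/eqP; field; apply/andP; split; lra.
by move=> m; apply: fraction_atM (fU m) (fV m); apply: monic_prod_XsubC.
Qed.

Lemma trackedX U G v k : tracked U G v ->
  tracked (fun m z => U m z ^+ k) (fun s => G s ^+ k) (v ^+ k).
Proof.
move=> tU; elim: k => [|k IH]; first exact: (tracked_cst 1).
by apply: tracked_ext (trackedM tU IH) => *; rewrite exprS.
Qed.

Variables (U : 'I_n -> nat -> R[i] -> R[i]) (phi : (nat -> bool) -> 'rV[R[i]]_n).
Variable v : 'rV[R[i]]_n.
Hypothesis phi_tracked :
  forall i, tracked (U i) (fun s => phi s ord0 i) (v ord0 i).

Lemma tracked_peval (p : mpoly.mpoly n R[i]) :
  tracked (fun m z => mpoly.meval (fun i => U i m z) p)
          (fun s => peval p (phi s)) (peval p v).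
Proof.
rewrite /peval; elim/mpoly.mpolyind: p => [|c X p _ _ IH].
  by apply: tracked_ext (tracked_cst 0) => *; rewrite mpoly.meval0.
pose monom (r : seq 'I_n) (x : 'I_n -> R[i]) :=
  \prod_(i <- r) x i ^+ mpoly.fun_of_multinom X i.
have tX r : tracked (fun m z => monom r (fun i => U i m z))
    (fun s => monom r (phi s ord0)) (monom r (v ord0)).
  elim: r => [|i r IHr].
    by apply: tracked_ext (tracked_cst 1) => *; rewrite /monom big_nil.
  apply: tracked_ext (trackedM (trackedX (mpoly.fun_of_multinom X i) (phi_tracked i)) IHr);
    by move=> *; rewrite /monom big_cons.
apply: tracked_ext (trackedD (trackedM (tracked_cst c) (tX (index_enum _))) IH);
  by move=> *; rewrite mpoly.mevalD mpoly.mevalZ mpoly.mevalX.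
Qed.

Lemma tracked_ucont V G w : tracked V G w -> ucont G.
Proof.
move=> [_ cV _] e e0; have e2 : 0 < e / 2 by lra.
have [m hm] := cV _ e2; exists m.+1 => s t st.
pose z := ctr m s + (rad m)%:C%C.
have zs : nc (z - ctr m s) = rad m.
  by rewrite /z addrAC subrr add0r nc_real gtr0_norm.
have hs := hm m (leqnn m) s z zs; rewrite (ctr_agree st) in zs.
have ht := hm m (leqnn m) t z zs.
by have := nc_triangle (V m z) (G s) (G t); rewrite (nc_distC (G s) (V m z)); lra.
Qed.

(** If p did not take the value p(v) on the image of phi, compactness would keep
p(phi) - p(v) away from 0. At a deep level the fraction p(U m) - p(v), which
vanishes at infinity, would then be near a nonzero constant on each circle. *)
Theorem tracked_rational_hull : rational_hull (range phi) v.
Proof.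
move=> p; apply: contrapT => nv; have tp := tracked_peval p.
pose G s := peval p (phi s) + (- peval p v).
have G0 s : G s != 0.
  rewrite /G subr_eq0; apply/eqP => h; apply: nv; exists (phi s) => //.
have cG : ucont G by apply: ucontD (ucont_cst _); apply: tracked_ucont tp.
have [e e0 eG] := ucont_bounded_below cG G0.
have e2 : 0 < e / 2 by lra.
have [_ /(_ _ e2) [m hm] fp] := tp; have {}hm := hm m (leqnn m).
have [N [d [fN sN]]] := fp m.
pose D := \prod_(a <- cs m) ('X - a%:P).
have mD : D \is monic by apply: monic_prod_XsubC.
have DE z : D.[z] ^+ d = \prod_(a <- cs m) (z - a) ^+ d.
  by rewrite horner_prodXsub prodrXl.
have {fp} [sc hsc] : exists sc : R[i] -> nat -> bool,
    forall c, c \in cs m -> ctr m (sc c) = c.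
  have H c : exists s, c \in cs m -> ctr m s = c.
    have [cin|cn] := boolP (c \in cs m); last by exists (fun=> false).
    by have [s sE] := cs_ctr cin; exists s.
  by have [sc hsc] := choice H; exists sc.
apply: (@no_fraction_near_constants _ (cs m) (rad m) d
         (N - peval p v *: D ^+ d) (fun c => G (sc c))) => //.
- exact: cs_sep.
- have := size_exp D d; rewrite {2}/D size_prod_XsubC /= mulnC => <-.
  by rewrite -ltnS prednK // size_poly_gt0 expf_neq0 // monic_neq0.
move=> c cin; split=> // z zc.
have zs : nc (z - ctr m (sc c)) = rad m by rewrite hsc.
have Dz : D.[z] != 0.
  rewrite horner_prodXsub prodf_seq_neq0; apply/allP => a ain /=.
  rewrite -nc_gt0; have [->|ac] := eqVneq a c; first by rewrite zc.
  have := cs_sep ain cin ac; have := nc_triangle z a c.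
  by rewrite (nc_distC a z) zc; have := rad_gt0 m; lra.
rewrite -DE hornerD hornerN hornerZ horner_exp -fN // -/D.
have -> : forall x y g w : R[i], x * w - y * w - (g - y) * w = (x - g) * w.
  by move=> x y g w; ring.
rewrite !ncM mulrA; apply: ler_wpM2r; first exact: nc_ge0.
by apply: le_trans (hm _ _ zs) _; have := eG (sc c); lra.
Qed.

End RationalHull.

(** * Polynomial convexity of separated Cantor sets *)

Section PolynomialConvexity.
Variable R : realType.

(** The two halves of a cylinder are sent to the two sides of a strip, whose
direction u may depend on the level of the cylinder. *)
Definition separating (h : (nat -> bool) -> R[i]) := forall k,
  exists u, exists2 d : R, 0 < d & forall s t, agree k s t ->
    s k = true -> t k = false -> d <= Re (u * (h s - h t)).

Lemma separating_injective h : separating h -> forall m, exists2 d : R, 0 < d &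
  forall s t, nc (h s - h t) < d -> agree m s t.
Proof.
move=> sep; elim=> [|m [d d0 IH]]; first by exists 1 => // s t _ i.
have [u [e e0 he]] := sep m.
have u0 : 0 < nc u + 1 by have := nc_ge0 u; lra.
have eu : 0 < e / (nc u + 1) by rewrite divr_gt0.
have far s t : agree m s t -> s m = true -> t m = false ->
    e / (nc u + 1) <= nc (h s - h t).
  move=> st sm tm; rewrite ler_pdivrMr //.
  have := he s t st sm tm; have := Re_le_nc (u * (h s - h t)).
  rewrite ncM; have := ler_norm (Re (u * (h s - h t))).
  by have := nc_ge0 (h s - h t); nra.
exists (Num.min d (e / (nc u + 1))) => [|s t]; first by rewrite lt_min d0.
rewrite lt_min => /andP[/IH st hst]; apply: agreeS => //.
case sm: (s m); case tm: (t m) => //.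
  by have := far s t st sm tm; lra.
by have := far t s (agree_sym st) tm sm; rewrite nc_distC; lra.
Qed.

(** Functions of finitely many digits are assembled from constants by gluing,
two halves of a cylinder at a time. *)
Lemma separating_dense (A : ((nat -> bool) -> R[i]) -> Prop) h f :
  bounded_algebra A -> A h -> separating h -> ucont f ->
  uclosure A (fun=> True) f.
Proof.
move=> algA Ah sep cf; apply: uclosure_lim => // e e0.
have [m hm] := cf e e0.
pose cut (s : nat -> bool) i := if (i < m)%N then s i else false.
exists (fun s => f (cut s)); last first.
  by move=> s _; apply: hm => i im; rewrite /cut im.
have cyl j s0 : uclosure A (agree (m - j) s0) (fun s => f (cut s)).
  elim: j s0 => [|j IH] s0.
    apply: uclosure_ext (uclosure_cst algA _ (f (cut s0))) => s s0s.
    congr f; apply/funext => i; rewrite /cut; case: ifP => // im.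
    by apply: s0s; rewrite subn0.
  have [mj|jm] := leqP m j.
    by apply: uclosureW (IH s0) => s; apply: agreeW; move/eqP: mj => ->.
  have mj : (m - j)%N = (m - j.+1).+1 by rewrite subnSK.
  set k := (m - j.+1)%N in mj *; have [u [d d0 hd]] := sep k.
  pose half b := fun i => if (i == k)%N then b else s0 i.
  have halfE b s : agree k.+1 (half b) s <-> agree k s0 s /\ s k = b.
    split=> [H|[H sk]].
      split=> [i ik|]; last by rewrite -H // /half eqxx.
      by have := H i (ltnW ik); rewrite /half ltn_eqF.
    apply: agreeS; last by rewrite /half eqxx.
    by move=> i ik; rewrite /half ltn_eqF // H.
  pose g s := Re (u * h s).
  have gst s t : agree k.+1 (half true) s -> agree k.+1 (half false) t ->
      g t + d <= g s.
    move=> /halfE[s0s sk] /halfE[s0t tk]; rewrite /g.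
    have := hd s t (agree_trans (agree_sym s0s) s0t) sk tk.
    by rewrite mulrBr ReB; lra.
  pose E := [set g t | t in agree k.+1 (half false)].
  have supE : has_sup E.
    split; first by exists (g (half false)), (half false).
    exists (g (half true) - d) => _ [t ht <-].
    by have := gst (half true) t (fun _ _ => erefl) ht; lra.
  have Cg : uclosure A (agree k s0) (fun s => u * h s).
    by apply: uclosureM (uclosure_cst _ _ _) (uclosure_incl _ Ah).
  apply: (@uclosure_glue _ _ _ algA _ (agree k.+1 (half true))
    (agree k.+1 (half false)) _ _ (sup E + d / 2) (d / 2) _ Cg).
  - by lra.
  - by move=> s s0s; case sk: (s k); [left|right]; apply/halfE.
  - move=> s hs; suff : sup E <= g s - d by rewrite /g; lra.
    apply: ge_sup; first by case: supE.
    by move=> _ [t ht <-]; have := gst s t hs ht; lra.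
  - move=> t ht; suff : g t <= sup E by rewrite /g; lra.
    by apply: ub_le_sup; [case: supE | exists t].
  - by rewrite -mj; apply: IH.
  - by rewrite -mj; apply: IH.
by have := cyl m (fun=> false); rewrite subnn; apply: uclosureW => s _ i.
Qed.

Variables (n : nat) (phi : (nat -> bool) -> 'rV[R[i]]_n).
Hypothesis phi_ucont : forall i, ucont (fun s => phi s ord0 i).
Hypothesis phi_bounded : forall i, exists B, forall s, nc (phi s ord0 i) <= B.

(** Polynomials are manipulated through the functions that they define. *)
Definition polyfun (F : 'rV[R[i]]_n -> R[i]) :=
  exists p : mpoly.mpoly n R[i], forall x, peval p x = F x.

Lemma polyfun_cst (c : R[i]) : polyfun (fun=> c).
Proof. by eexists => x; apply: mpoly.mevalC. Qed.

Lemma polyfunD F G : polyfun F -> polyfun G -> polyfun (fun x => F x + G x).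
Proof.
move=> [p pF] [q qG]; eexists => x; rewrite -pF -qG; exact: mpoly.mevalD.
Qed.

Lemma polyfunM F G : polyfun F -> polyfun G -> polyfun (fun x => F x * G x).
Proof.
move=> [p pF] [q qG]; eexists => x; rewrite -pF -qG; exact: mpoly.mevalM.
Qed.

Lemma polyfun_coord i : polyfun (fun x => x ord0 i).
Proof. by eexists => x; apply: mpoly.mevalXU. Qed.

Lemma polyfun_sum (F : 'I_n -> 'rV[R[i]]_n -> R[i]) :
  (forall i, polyfun (F i)) -> polyfun (fun x => \sum_(i < n) F i x).
Proof.
move=> pF; elim: (index_enum _) => [|i r IH].
  by under eq_fun do rewrite big_nil; apply: polyfun_cst.
by under eq_fun do rewrite big_cons; apply: polyfunD.
Qed.

Definition polyfun_on (f : (nat -> bool) -> R[i]) :=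
  exists2 F, polyfun F & forall s, f s = F (phi s).

Lemma polyfun_on_algebra : bounded_algebra polyfun_on.
Proof.
split=> [c|f g [F pF fF] [G pG gG]|f g [F pF fF] [G pG gG]|f [F [p pF] fF]].
- by exists (fun=> c) => //; apply: polyfun_cst.
- by exists (fun x => F x + G x) => [|s]; [exact: polyfunD | rewrite fF gG].
- by exists (fun x => F x * G x) => [|s]; [exact: polyfunM | rewrite fF gG].
suff [B hB] : exists B, forall s, nc (peval p (phi s)) <= B.
  by exists B => s; rewrite fF -pF.
rewrite /peval; elim/mpoly.mpolyind: p {pF} => [|c X p _ _ [B hB]].
  by exists 0 => s; rewrite mpoly.meval0 nc0.
have [C hC] : exists C, forall s,
    nc (\prod_(i < n) phi s ord0 i ^+ mpoly.fun_of_multinom X i) <= C.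
  elim: (index_enum _) => [|i r [C hC]].
    by exists 1 => s; rewrite big_nil nc1.
  have [D hD] := phi_bounded i.
  exists (D ^+ mpoly.fun_of_multinom X i * C) => s; rewrite big_cons ncM ncX.
  apply: ler_pM; rewrite ?exprn_ge0 ?nc_ge0 //.
  by apply: lerXn2r; rewrite ?nnegrE ?nc_ge0 // (le_trans (nc_ge0 _) (hD s)).
exists (nc c * C + B) => s.
rewrite mpoly.mevalD mpoly.mevalZ mpoly.mevalX; apply: le_trans (ncD _ _) _.
by apply: lerD => //; rewrite ncM ler_wpM2l ?nc_ge0.
Qed.

(** Since polynomials are dense in the continuous functions on the image, for z
outside it the functions
(phi_i - z_i)^* / |phi - z| ^ 2 are approximated by polynomials Q_i; then
1 - \sum_i (X_i - z_i) Q_i is small on the image and has value 1 at z. *)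
Theorem polynomially_convex_separating (j : 'I_n) :
  separating (fun s => phi s ord0 j) -> polynomially_convex (range phi).
Proof.
move=> sep; apply/seteqP; split; last first.
  move=> _ [s _ <-] p; apply: ereal_sup_ubound.
  by exists (phi s) => //; exists s.
move=> z zhull; apply: contrapT => nz.
have algP := polyfun_on_algebra.
have dense f : ucont f -> uclosure polyfun_on (fun=> True) f.
  apply: (separating_dense algP _ sep).
  by exists (fun x => x ord0 j) => //; apply: polyfun_coord.
pose w i s := phi s ord0 i + (- z ord0 i).
have cw i : ucont (w i) by apply: ucontD (ucont_cst _).
have wB i : exists2 B, 0 < B & forall s, nc (w i s) <= B.
  have [B hB] := phi_bounded i.
  exists (`|B| + nc (z ord0 i) + 1) => [|s].
    by have := normr_ge0 B; have := nc_ge0 (z ord0 i); lra.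
  have := ncB (phi s ord0 i) (z ord0 i); have := hB s; have := ler_norm B.
  by rewrite /w; lra.
pose W s := \sum_(i < n) w i s * (w i s)^*%C.
have cW : ucont W.
  by apply: ucont_sum => i; have [B _ hB] := wB i; apply: ucont_sqr_nc (hB).
have WE s : W s = (\sum_(i < n) nc (w i s) ^+ 2)%:C%C.
  by rewrite /W rmorph_sum; apply: eq_bigr => i _; rewrite mul_conj.
have W0 s : W s != 0.
  rewrite WE realC_eq0 psumr_eq0 => [|i _]; last by rewrite exprn_ge0 ?nc_ge0.
  apply/negP => /allP wi0; apply: nz; exists s => //; apply/rowP => i.
  have := wi0 i; rewrite mem_index_enum => /(_ isT) /=.
  rewrite expf_eq0 /= nc_eq0 /w subr_eq0 => /eqP.
  by rewrite !(ord1 0).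
have [e e0 eW] := ucont_bounded_below cW W0.
have CW : uclosure polyfun_on (fun=> True) (fun s => (W s)^-1).
  apply: (uclosure_inv algP e0) => [|s _]; first exact: dense.
  apply: le_trans (eW s) _; rewrite WE nc_real Re_real //.
have Cc i : uclosure polyfun_on (fun=> True) (fun s => (w i s)^*%C * (W s)^-1).
  apply: uclosureM CW => //; apply: dense => d d0; have [m hm] := cw i d d0.
  by exists m => s t /hm; rewrite -rmorphB nc_conj.
have small : 0 < (2 * n.+1%:R)^-1 :> R by rewrite invr_gt0 mulr_gt0 ?ltr0n.
have HQ i : exists Q, polyfun Q /\ forall s,
    nc (w i s * ((w i s)^*%C * (W s)^-1 - Q (phi s))) <= (2 * n.+1%:R)^-1.
  have [B B0 hB] := wB i.
  have [|g [Q pQ gQ] hg] := Cc i ((2 * n.+1%:R)^-1 / B); first by rewrite divr_gt0.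
  exists Q; split=> // s; rewrite ncM -gQ -[leRHS](divfK (x := B)) ?gt_eqF // mulrC.
  by apply: ler_pM; rewrite ?nc_ge0 ?hg.
have [Q hQ] := choice HQ.
have [P PE] : polyfun
    (fun x => 1 + -1 * \sum_(i < n) (x ord0 i + - z ord0 i) * Q i x).
  apply: polyfunD (polyfun_cst 1) (polyfunM (polyfun_cst (-1)) _).
  apply: polyfun_sum => i; apply: polyfunM (hQ i).1.
  exact: polyfunD (polyfun_coord i) (polyfun_cst _).
have := zhull P; rewrite PE big1 => [|i _]; last by rewrite subrr mul0r.
rewrite mulr0 addr0 nc1; apply/negP; rewrite -ltNge.
apply: (@le_lt_trans _ _ (2^-1)%:E); last by rewrite lte_fin; lra.
apply: ub_ereal_sup => _ [_ [s _ <-] <-]; rewrite lee_fin PE.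
have -> : 1 + -1 * \sum_(i < n) (phi s ord0 i - z ord0 i) * Q i (phi s) =
    \sum_(i < n) w i s * ((w i s)^*%C * (W s)^-1 - Q i (phi s)).
  transitivity (\sum_(i < n) (w i s * (w i s)^*%C * (W s)^-1 -
      (phi s ord0 i - z ord0 i) * Q i (phi s))).
    by rewrite sumrB -mulr_suml -/(W s) divff // mulN1r.
  by apply: eq_bigr => i _; rewrite mulrBr mulrA.
apply: (@le_trans _ _ (\sum_(i < n) (2 * n.+1%:R)^-1)).
  elim/big_rec2: _ => [|i y x _ yx]; first by rewrite nc0.
  by apply: le_trans (ncD _ _) _; apply: lerD => //; case: (hQ i).
rewrite sumr_const card_ord -[_ *+ n]mulr_natl ler_pdivrMr ?mulr_gt0 ?ltr0n //.
by rewrite mulrA mulVf ?pnatr_eq0 // mul1r ler_nat.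
Qed.

End PolynomialConvexity.

(** * Recognizing Cantor sets *)

Section MiddleThirds.
Variable R : realType.
Implicit Types (s t : nat -> bool) (x y : R).

Definition shift s i := s i.+1 : bool.

Fixpoint ternary_partial n s : R :=
  if n is m.+1 then (ternary_partial m (shift s) + 2 * (s 0%N)%:R) / 3 else 0.

Lemma ternary_partialS n s :
  `|ternary_partial n s - ternary_partial n.+1 s| <= 1 * 3^-1 ^+ n.
Proof.
elim: n s => [|n IH] s.
  rewrite /= sub0r normrN add0r expr0 mulr1.
  by case: (s 0%N); rewrite /= ger0_norm; lra.
have -> : ternary_partial n.+1 s - ternary_partial n.+2 s =
    (ternary_partial n (shift s) - ternary_partial n.+1 (shift s)) / 3.
  by rewrite /=; field.
rewrite normrM (@ger0_norm _ 3^-1) ?invr_ge0 // exprSr mulrA.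
by apply: ler_wpM2r => //; rewrite invr_ge0.
Qed.

Lemma ternary_ex : exists c : (nat -> bool) -> R, forall s n,
  `|ternary_partial n s - c s| <= 1 / (1 - 3^-1) * 3^-1 ^+ n.
Proof.
have H s : exists c, forall n,
    `|ternary_partial n s - c| <= 1 / (1 - 3^-1) * 3^-1 ^+ n.
  apply: (@geometric_cauchy_real R (fun n => ternary_partial n s)); try by lra.
  by move=> n; apply: ternary_partialS.
by have [c hc] := choice H; exists c.
Qed.

Definition ternary : (nat -> bool) -> R := projT1 (cid ternary_ex).

Lemma eq_of_geometric x y (K : R) :
  (forall n, `|x - y| <= K * 3^-1 ^+ n) -> x = y.
Proof.
move=> H; apply/eqP; rewrite -subr_eq0 -normr_eq0 eq_le normr_ge0 andbT.
rewrite leNgt; apply/negP => xy; have e0 : 0 < `|x - y| / 2 by lra.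
have [||m /(_ m (leqnn m)) hm] := @geometric_small R K 3^-1 _ _ _ e0; try by lra.
by have := H m; lra.
Qed.

Lemma ternaryE s : ternary s = (ternary (shift s) + 2 * (s 0%N)%:R) / 3.
Proof.
have hc := projT2 (cid ternary_ex); rewrite -/ternary in hc.
apply: (@eq_of_geometric _ _ (1 / (1 - 3^-1) * (3^-1 + 3^-1))) => n.
have h1 := hc s n.+1; have h2 := hc (shift s) n.
move: h1 h2; rewrite /= exprS !ler_norml; move: (3^-1 ^+ n) => q.
lra.
Qed.

Lemma ternary_ge0_le1 s : 0 <= ternary s <= 1.
Proof.
have hc := projT2 (cid ternary_ex); rewrite -/ternary in hc.
have bd n t : 0 <= ternary_partial n t <= 1.
  elim: n t => [|n IH] t /=; first by lra.
  by have := IH (shift t); case: (t 0%N) => /=; lra.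
apply/andP; split; rewrite leNgt; apply/negP => h.
  have e0 : 0 < - ternary s by lra.
  have [||m /(_ m (leqnn m)) hm] :=
    @geometric_small R (1 / (1 - 3^-1) * 2) 3^-1 _ _ _ e0; try by lra.
  by have := hc s m; have := bd m s; rewrite ler_norml; lra.
have e0 : 0 < ternary s - 1 by lra.
have [||m /(_ m (leqnn m)) hm] :=
  @geometric_small R (1 / (1 - 3^-1) * 2) 3^-1 _ _ _ e0; try by lra.
by have := hc s m; have := bd m s; rewrite ler_norml; lra.
Qed.

Lemma ternary_agree m s t : agree m s t ->
  `|ternary s - ternary t| <= 3^-1 ^+ m.
Proof.
elim: m s t => [|m IH] s t st.
  have := ternary_ge0_le1 s; have := ternary_ge0_le1 t.
  by rewrite expr0 ler_norml; lra.
have := IH (shift s) (shift t); rewrite (ternaryE s) (ternaryE t) (st 0%N) //.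
move=> /(_ (fun i im => st i.+1 im)); rewrite exprS !ler_norml.
by move: (3^-1 ^+ m) => q; lra.
Qed.

Lemma ternary_injective m s t :
  `|ternary s - ternary t| < 3^-1 ^+ m -> agree m s t.
Proof.
elim: m s t => [|m IH] s t h; first by [].
have q1 : (3^-1 : R) ^+ m <= 1 by rewrite exprn_ile1 ?invr_ge0 //; lra.
move: h; rewrite exprS (ternaryE s) (ternaryE t) => h.
have st0 : s 0%N = t 0%N.
  have := ternary_ge0_le1 (shift s); have := ternary_ge0_le1 (shift t).
  by move: h; rewrite ltr_norml; case: (s 0%N); case: (t 0%N) => //=; lra.
have : agree m (shift s) (shift t).
  by apply: IH; move: h; rewrite st0 !ltr_norml; lra.
by move=> st [|i] //; rewrite ltnS => /st.
Qed.

Lemma cantor_stage01 n x : cantor_stage n x -> 0 <= x <= 1.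
Proof.
elim: n x => [|n IH] x /=; first by rewrite in_itv.
by case=> [[y /IH hy <-]|[y /IH hy <-]]; lra.
Qed.

Lemma ternary_in s : @middle_thirds R (ternary s).
Proof.
move=> n _; elim: n s => [|n IH] s /=.
  by rewrite in_itv /= ternary_ge0_le1.
rewrite ternaryE; case: (s 0%N) => /=; [right|left];
  exists (ternary (shift s)) => //; lra.
Qed.

(** The shift on ternary digits; its orbit reads off the digits of x. *)
Definition third_map x := if x < 2^-1 then 3 * x else 3 * x - 2.

Lemma third_map_in x : @middle_thirds R x -> @middle_thirds R (third_map x).
Proof.
move=> xM n _; rewrite /third_map.
case: (xM n.+1 Logic.I) => /= [[y yn]|[y yn]] <-; have := cantor_stage01 yn.
  by move=> y01; rewrite ifT; [have -> : 3 * (y / 3) = y by field | lra].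
move=> y01; rewrite ifF; last by apply/negbTE; rewrite -leNgt; lra.
by have -> : 3 * ((y + 2) / 3) - 2 = y by field.
Qed.

Definition ternary_digits x i := ~~ (iter i third_map x < 2^-1).

Lemma ternary_digitsK x : @middle_thirds R x -> ternary (ternary_digits x) = x.
Proof.
move=> xM; apply: (@eq_of_geometric _ _ 1) => n; rewrite mul1r.
elim: n x xM => [|n IH] x xM.
  have := cantor_stage01 (xM 0%N Logic.I).
  by have := ternary_ge0_le1 (ternary_digits x); rewrite expr0 ler_norml; lra.
rewrite ternaryE.
have -> : shift (ternary_digits x) = ternary_digits (third_map x).
  by apply/funext => i; rewrite /shift /ternary_digits iterSr.
have := IH _ (third_map_in xM); rewrite exprS !ler_norml [ternary_digits x 0%N]/ternary_digits /=.
move: (ternary _) (3^-1 ^+ n) => T q; rewrite /third_map.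
by case: ifP => _ /=; lra.
Qed.

End MiddleThirds.

Section CantorCriterion.
Variable R : realType.

Lemma within_continuous_ball (K L : numFieldType) (T : pseudoMetricType K)
    (U : pseudoMetricType L) (A : set T) (f : T -> U) :
  (forall x, A x -> forall e : L, 0 < e -> exists2 d : K, 0 < d &
     forall y, A y -> ball x d y -> ball (f x) e (f y)) ->
  {within A, continuous f}.
Proof.
move=> H; apply/subspace_continuousP => x Ax.
apply/cvg_ballP => e e0; have [d d0 hd] := H x Ax e e0.
rewrite /within /=; near_simpl.
apply/nbhs_ballP; exists d => // y xy Ay; exact: hd.
Qed.

Lemma complex_lt_normc (z : R[i]) (d : R) : (`|z| < d%:C%C) = (nc z < d).
Proof. by rewrite normc_def ltcR; case: z. Qed.

Lemma ball_row (n : nat) (x y : 'rV[R[i]]_n) (d : R) : 0 < d ->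
  ball x (d%:C%C) y <-> forall i, nc (x ord0 i - y ord0 i) < d.
Proof.
move=> d0; split=> [[_ H] i|H].
  by have := H ord0 i; rewrite -ball_normE /= complex_lt_normc.
split=> [|i j]; first by rewrite ltcR.
by rewrite (ord1 i) -ball_normE /= complex_lt_normc.
Qed.

(** The coding of a set by binary sequences, composed with the ternary
expansion, is the homeomorphism. *)
Theorem is_cantor_set_range (n : nat) (phi : (nat -> bool) -> 'rV[R[i]]_n) :
    (forall i, ucont (fun s => phi s ord0 i)) ->
    (forall m, exists2 d : R, 0 < d & forall s t,
       (forall i, nc (phi s ord0 i - phi t ord0 i) < d) -> agree m s t) ->
  is_cantor_set R (range phi).
Proof.
move=> cphi iphi.
have phi_inj : injective phi.
  move=> s t st; apply/funext => i; have [d d0 hd] := iphi i.+1.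
  by apply: (hd s t) => // j; rewrite st subrr nc0.
have ter_inj : injective (@ternary R).
  move=> s t st; apply/funext => i; apply: (@ternary_injective R i.+1) => //.
  by rewrite st subrr normr0 exprn_gt0 // invr_gt0.
have uphi (e : R) : 0 < e -> exists m, forall s t, agree m s t ->
    forall i, nc (phi s ord0 i - phi t ord0 i) < e.
  move=> e0; have e2 : 0 < e / 2 by lra.
  have [M hM] := choice (fun i => cphi i _ e2).
  exists (\max_i M i)%N => s t st i.
  by have := hM i s t (agreeW (leq_bigmax i) st); lra.
have ex_inv (T : Type) (c : (nat -> bool) -> T) : injective c ->
    exists d : T -> nat -> bool, forall s, d (c s) = s.
  move=> cI; have H x : exists s, forall t, x = c t -> s = t.
    have [[t ->]|nt] := pselect (exists t, x = c t).
      by exists t => t' /cI.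
    by exists (fun=> false) => t xt; case: nt; exists t.
  by have [d hd] := choice H; exists d => s; apply: hd.
have [iph iphK] := ex_inv _ _ phi_inj.
have [ite iteK] := ex_inv _ _ ter_inj.
have terM y : @middle_thirds R y -> exists s, y = ternary R s.
  by move=> yM; exists (ternary_digits y); rewrite ternary_digitsK.
exists (fun x => ternary R (iph x)), (fun y => phi (ite y)); split.
- by split=> [_ [s _ <-]|y _]; [exact: ternary_in | exists (ite y)].
- by move=> x /set_mem [s _ <-]; rewrite iphK iteK.
- by move=> y /set_mem /terM [s ->]; rewrite iteK iphK.
- apply: within_continuous_ball => _ [s _ <-] e e0.
  have [|||m /(_ m (leqnn m)) hm] := @geometric_small R 1 3^-1 (e / 2); try by lra.
  have [d d0 hd] := iphi m; exists d%:C%C; first by rewrite ltcR.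
  move=> _ [t _ <-] /(ball_row _ _ d0) /hd /ternary_agree => h.
  rewrite -ball_normE /= !iphK; have := h R; lra.
apply: within_continuous_ball => _ /terM [s ->] e e0.
have eE : e = (Re e)%:C%C by rewrite RRe_real // ger0_real // ltW.
have e0' : 0 < Re e by rewrite eE ltcR in e0.
have [m hm] := uphi _ e0'; exists (3^-1 ^+ m); first by rewrite exprn_gt0 // invr_gt0.
move=> _ /terM [t ->]; rewrite -ball_normE /= => /ternary_injective /hm h.
by rewrite !iteK eE; apply/ball_row.
Qed.

End CantorCriterion.

(** * Cauchy transforms of a self-similar planar set *)

Section Construction.
Variable R : realType.
Implicit Types (z p : R[i]) (v w : seq bool) (s t : nat -> bool).

(** The planar Cantor set is the set of sums of +- beta ^ k. Its ratio 2 / 3 is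
below 1 / sqrt 2, so that it is totally disconnected, and above 1 / 2, so that
it has dimension larger than 1 and the Cauchy transform of its uniform measure
extends continuously across it. The factor i makes even digits govern the real
part and odd digits the imaginary part. *)
Definition beta : R[i] := Complex 0 (2 / 3).
Definition sgnb (b : bool) : R[i] := if b then 1 else -1.
(** The partial sums for finite words, first digit first: prefixing a letter is
then one of the two similarities that generate the set. *)
Definition pos w : R[i] := foldr (fun b p => sgnb b + beta * p) 0 w.
Definition rad m : R := 5^-1 * (2 / 3) ^+ m.

Fixpoint avg m (f : seq bool -> R[i]) : R[i] :=
  if m is k.+1 then
    (avg k (fun v => f (true :: v)) + avg k (fun v => f (false :: v))) / 2
  else f [::].

(** The Cauchy transform of the uniform measure on the centres of level m. *)
Definition resolvent m z := avg m (fun v => (z - pos v)^-1).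

Lemma nc_beta : nc beta = 2 / 3.
Proof. by rewrite /= expr0n /= add0r sqrtr_sqr ger0_norm //; lra. Qed.

Lemma beta_neq0 : beta != 0.
Proof. by rewrite -nc_gt0 nc_beta; lra. Qed.

Lemma rad_gt0 m : 0 < rad m.
Proof. by rewrite /rad mulr_gt0 ?exprn_gt0 //; lra. Qed.

Lemma radS m : rad m.+1 = 2 / 3 * rad m.
Proof. by rewrite /rad exprS; ring. Qed.

Lemma rad_le m : rad m <= 5^-1.
Proof.
by rewrite /rad ler_piMr ?exprn_ile1 //; lra.
Qed.

Lemma nc_half : nc (2^-1 : R[i]) = 2^-1.
Proof. by rewrite ncV nc_nat. Qed.

Lemma pos_box w : `|Re (pos w)| <= 9 / 5 /\ `|Im (pos w)| <= 6 / 5.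
Proof.
elim: w => [|b w [IHr IHi]] /=; first by rewrite normr0; lra.
rewrite ReD ImD ReM ImM /=; move: IHr IHi.
case: (pos w) => x y /=; rewrite !ler_norml.
by case: b => /=; rewrite /= ?oppr0; lra.
Qed.

Lemma nc_pos w : nc (pos w) <= 3.
Proof. by have [h1 h2] := pos_box w; have := nc_le_ReIm (pos w); lra. Qed.

Lemma pos_rcons w b : pos (rcons w b) = pos w + beta ^+ size w * sgnb b.
Proof.
elim: w => [|c w IH] /=; first by rewrite mulr0 addr0 add0r expr0 mul1r.
by rewrite IH exprS; ring.
Qed.

Lemma nc_sgnb b : nc (sgnb b) = 1.
Proof. by case: b; rewrite /sgnb ?ncN nc1. Qed.

Lemma nc_sgnb_sub b : nc (sgnb b - sgnb (~~ b)) = 2.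
Proof.
have -> : sgnb b - sgnb (~~ b) = 2 * sgnb b by case: b; rewrite /sgnb /=; ring.
by rewrite ncM nc_sgnb nc_nat mulr1.
Qed.

Lemma nc_pos_rcons w b : nc (pos (rcons w b) - pos w) = (2 / 3) ^+ size w.
Proof. by rewrite pos_rcons addrAC subrr add0r ncM ncX nc_beta nc_sgnb mulr1. Qed.

Lemma pos_split v w : Re (sgnb true + beta * pos v - (sgnb false + beta * pos w))
  >= 2 / 5.
Proof.
have [_] := pos_box v; have [_] := pos_box w.
rewrite ReB !ReD !ReM /=; case: (pos v) (pos w) => [x y] [x' y'] /=.
by rewrite !ler_norml; lra.
Qed.

(** Up to a similarity of ratio (2 / 3) ^ k, the first digit k where the words
differ separates the real parts by 2 / 5, whatever the later digits. *)
Lemma pos_sep v w : size v = size w -> v != w -> 2 * rad (size v) < nc (pos v - pos w).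
Proof.
elim: v w => [|b v IH] [|c w] //= [] vw.
have [<-|bc _] := eqVneq b c.
  rewrite eqseq_cons eqxx /= => /(IH w vw) h.
  rewrite opprD addrACA subrr add0r -mulrBr ncM nc_beta radS.
  by lra.
have r1 : rad (size v).+1 <= 2 / 15 by rewrite radS; have := rad_le (size v); lra.
apply: (@lt_le_trans _ _ (2 / 5)); first by lra.
case: b c bc => [] [] // _.
  exact: le_trans (pos_split v w) (le_trans (ler_norm _) (Re_le_nc _)).
rewrite nc_distC.
exact: le_trans (pos_split w v) (le_trans (ler_norm _) (Re_le_nc _)).
Qed.

Lemma avg_ext m f g : (forall v, size v = m -> f v = g v) -> avg m f = avg m g.
Proof.
elim: m f g => [|m IH] f g fg /=; first exact: fg.
by congr ((_ + _) / _); apply: IH => v vm; apply: fg; rewrite /= vm.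
Qed.

Lemma avgB m f g : avg m (fun v => f v - g v) = avg m f - avg m g.
Proof. by elim: m f g => [|m IH] f g //=; rewrite !IH; ring. Qed.

Lemma avgM m c f : avg m (fun v => c * f v) = c * avg m f.
Proof. by elim: m f => [|m IH] f //=; rewrite !IH; ring. Qed.

Lemma avg_cst m c : avg m (fun=> c) = c.
Proof. by elim: m => [|m IH] //=; rewrite IH; field. Qed.

Lemma nc_avg m f (B : R) : (forall v, size v = m -> nc (f v) <= B) ->
  nc (avg m f) <= B.
Proof.
elim: m f => [|m IH] f fB /=; first exact: fB.
rewrite ncM nc_half ler_pdivrMr //; apply: le_trans (ncD _ _) _.
rewrite mulr_natr mulr2n.
by apply: lerD; apply: IH => v vm; apply: fB; rewrite /= vm.
Qed.

Lemma nc_avg_near m f c (B : R) : (forall v, size v = m -> nc (f v - c) <= B) ->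
  nc (avg m f - c) <= B.
Proof. by rewrite -{2}(avg_cst m c) -avgB; apply: nc_avg. Qed.

Lemma avg_last m f :
  avg m.+1 f = avg m (fun v => (f (rcons v true) + f (rcons v false)) / 2).
Proof.
elim: m f => [|m IH] f //.
transitivity ((avg m.+1 (fun v => f (true :: v)) +
  avg m.+1 (fun v => f (false :: v))) / 2) => //.
by rewrite (IH (fun v => f (true :: v))) (IH (fun v => f (false :: v))).
Qed.

Lemma fraction_at_avg (D : {poly R[i]}) m (F : seq bool -> R[i] -> R[i]) c :
  D \is monic -> (forall v, size v = m -> fraction_at D (F v) c) ->
  fraction_at D (fun z => avg m (fun v => F v z)) c.
Proof.
move=> mD; elim: m F => [|m IH] F hF /=; first exact: hF.
have -> : c = (c + c) * 2^-1 by field.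
apply: (fraction_atM mD) (fraction_at_cst D 2^-1); apply: (fraction_atD mD).
  by apply: (IH (fun v => F (true :: v))) => v vm; apply: hF; rewrite /= vm.
by apply: (IH (fun v => F (false :: v))) => v vm; apply: hF; rewrite /= vm.
Qed.

Lemma inv_sub_le (x y : R[i]) (d : R) : 0 < d -> d <= nc x -> d <= nc y ->
  nc (x^-1 - y^-1) <= nc (x - y) / d ^+ 2.
Proof.
move=> d0 dx dy.
have x0 : x != 0 by rewrite -nc_gt0; lra.
have y0 : y != 0 by rewrite -nc_gt0; lra.
have -> : x^-1 - y^-1 = (y - x) * (x * y)^-1 by field; rewrite x0 y0.
rewrite ncM nc_distC ncV ncM; apply: ler_wpM2l; first exact: nc_ge0.
rewrite lef_pV2 ?posrE ?mulr_gt0 ?exprn_gt0 //; try lra.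
by rewrite expr2; apply: ler_pM; rewrite ?(ltW d0).
Qed.

Lemma resolvent_regular m z z' (d : R) : 0 < d ->
    (forall w, d <= nc (z - pos w)) -> (forall w, d <= nc (z' - pos w)) ->
  nc (resolvent m z - resolvent m.+1 z') <= (nc (z - z') + (2 / 3) ^+ m) / d ^+ 2.
Proof.
move=> d0 hz hz'; rewrite /resolvent avg_last -avgB; apply: nc_avg => v vm.
have one b : nc ((z - pos v)^-1 - (z' - pos (rcons v b))^-1) <=
    (nc (z - z') + (2 / 3) ^+ m) / d ^+ 2.
  apply: le_trans (inv_sub_le d0 _ _) _ => //.
  rewrite ler_pM2r ?invr_gt0 ?exprn_gt0 //.
  have -> : z - pos v - (z' - pos (rcons v b)) = (z - z') + (pos (rcons v b) - pos v).
    by ring.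
  by apply: le_trans (ncD _ _) _; rewrite nc_pos_rcons vm.
have h1 := one true; have h2 := one false.
set X := (z - pos v)^-1 in h1 h2 *; set Y1 := (z' - _)^-1 in h1 *.
set Y2 := (z' - _)^-1 in h2 *.
have -> : X - (Y1 + Y2) / 2 = ((X - Y1) + (X - Y2)) / 2 by field.
rewrite ncM nc_half; have := ncD (X - Y1) (X - Y2); lra.
Qed.

(** Near one half of the set the transform is a rescaled copy of the transform of
the previous level, up to the contribution of the other half. *)
Lemma resolvent_rec m b z :
  resolvent m.+1 (sgnb b + beta * z) =
  (2 * beta)^-1 * (resolvent m z +
     resolvent m (z + (sgnb b - sgnb (~~ b)) / beta)).
Proof.
have b0 := beta_neq0; rewrite /resolvent /=.
have E c : avg m (fun v => (sgnb b + beta * z - (sgnb c + beta * pos v))^-1) =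
    beta^-1 * avg m (fun v => (z + (sgnb b - sgnb c) / beta - pos v)^-1).
  rewrite -avgM; apply: avg_ext => v _; rewrite -invfM; congr (_^-1).
  by field.
rewrite (E true) (E false) invfM; case: b {E} => /=.
  by rewrite subrr mul0r addr0; ring.
by rewrite subrr mul0r addr0; ring.
Qed.

Lemma near_step w b z z' : nc (z - pos w) = rad (size w) ->
  nc (z' - pos (rcons w b)) = rad (size w).+1 ->
  nc (z - z') <= 4 / 3 * (2 / 3) ^+ size w.
Proof.
move=> zw zw'.
have -> : z - z' = (z - pos w) + ((pos w - pos (rcons w b)) + (pos (rcons w b) - z')).
  by ring.
apply: le_trans (ncD _ _) _; rewrite zw.
have := ncD (pos w - pos (rcons w b)) (pos (rcons w b) - z').
rewrite (nc_distC (pos w)) nc_pos_rcons (nc_distC _ z') zw' radS /rad.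
lra.
Qed.

(** Self-similarity reduces the comparison of two consecutive levels near a
point of the set to the same comparison one level below, contracted by
1 / |2 beta| = 3 / 4, and to a regular term of size 15 (2 / 3) ^ m. The
subtracted term absorbs the latter: 3 / 4 (- 135 + 15) = - 135 (2 / 3). *)
Lemma resolvent_self w b z z' : nc (z - pos w) = rad (size w) ->
  nc (z' - pos (rcons w b)) = rad (size w).+1 ->
  nc (resolvent (size w) z - resolvent (size w).+1 z') <=
    145 * (3 / 4) ^+ size w - 135 * (2 / 3) ^+ size w.
Proof.
elim: w z z' => [|c w IH] z z' zw zw'.
  have r1 : rad 1 = 2 / 15 by rewrite /rad expr1; field.
  have r0 : rad 0 = 5^-1 by rewrite /rad expr0 mulr1.
  have h0 : nc (resolvent 0 z) = 5.
    by rewrite /resolvent /= ncV; move: zw => /= ->; rewrite r0 invrK.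
  move: zw'; rewrite /= r1 mulr0 addr0 => zw'.
  have h1 : nc (resolvent 1 z') <= 5.
    have nb : nc ((z' - sgnb b)^-1) = 15 / 2 by rewrite ncV zw'; field.
    have nb' : nc ((z' - sgnb (~~ b))^-1) <= 1.
      rewrite ncV invf_le1; last first.
        rewrite nc_gt0; apply/negP => /eqP h; move: zw'.
        have -> : z' - sgnb b = (z' - sgnb (~~ b)) + (sgnb (~~ b) - sgnb b) by ring.
        by rewrite h add0r nc_distC nc_sgnb_sub; lra.
      have := nc_triangle z' (sgnb b) (sgnb (~~ b)).
      have := nc_sgnb_sub b.
      rewrite (nc_distC (sgnb b) z') zw'; lra.
    have := ncD (z' - sgnb b)^-1 (z' - sgnb (~~ b))^-1.
    rewrite /resolvent /= !mulr0 !addr0 ncM nc_half.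
    by case: (b) nb nb' => /= nb nb'; rewrite -?[_ + (z' - sgnb true)^-1]addrC; lra.
  by have := ncB (resolvent 0 z) (resolvent 1 z'); rewrite h0 !expr0; lra.
have b0 := beta_neq0.
pose y := (z - sgnb c) / beta; pose y' := (z' - sgnb c) / beta.
have zE : z = sgnb c + beta * y by rewrite /y; field.
have zE' : z' = sgnb c + beta * y' by rewrite /y'; field.
have yw : nc (y - pos w) = rad (size w).
  move: zw; rewrite zE /= opprD addrACA subrr add0r -mulrBr ncM nc_beta radS.
  by lra.
have yw' : nc (y' - pos (rcons w b)) = rad (size w).+1.
  move: zw'; rewrite zE' /= opprD addrACA subrr add0r -mulrBr ncM nc_beta.
  by rewrite [in RHS]radS; lra.
have h1 := IH y y' yw yw'.
(* The other half of the set, seen from y after rescaling, is displaced by tau,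
   that is vertically by 3, more than the total height of the set. *)
pose tau := (sgnb c - sgnb (~~ c)) / beta.
have Imtau : `|Im tau| = 3.
  have -> : tau = sgnb c * Complex 0 (- 3).
    rewrite /tau; apply: (mulIf b0); rewrite divfK //.
    by apply/eqP; rewrite eq_complex /beta; case: (c) => /=; apply/andP; split;
      apply/eqP; lra.
  by case: (c); rewrite ImM /=; [rewrite mul1r | rewrite mulN1r];
    rewrite ?mul0r ?addr0 ?oppr0 ?mulr0 ?addr0 ?normrN ?opprK ger0_norm.
have away x u v : nc (x - pos u) <= 5^-1 -> 2 / 5 <= nc (x + tau - pos v).
  move=> xu; apply: le_trans (Im_le_nc _).
  have := Im_le_nc (x - pos u); have [_] := pos_box u; have [_] := pos_box v.
  rewrite !ImB ImD; move: Imtau xu.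
  move: (Im tau) (Im x) (Im (pos u)) (Im (pos v)) (nc _) => T X P Q N.
  have [T0|T0] := leP 0 T.
    by rewrite (ger0_norm T0) => TE ? ; rewrite ler_norml => ?;
      rewrite ler_norml => ?; rewrite ler_norml => ?; rewrite ler_normr; lra.
  by rewrite (ltr0_norm T0) => TE ? ; rewrite ler_norml => ?;
      rewrite ler_norml => ?; rewrite ler_norml => ?; rewrite ler_normr; lra.
have d0 : 0 < 2 / 5 :> R by lra.
have h2 := @resolvent_regular (size w) (y + tau) (y' + tau) (2 / 5) d0.
have {}h2 : nc (resolvent (size w) (y + tau) - resolvent (size w).+1 (y' + tau))
    <= 15 * (2 / 3) ^+ size w.
  apply: le_trans (h2 _ _) _.
  - by move=> u; apply: (away y w); rewrite yw rad_le.
  - by move=> u; apply: (away y' (rcons w b)); rewrite yw' rad_le.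
  have := near_step yw yw'.
  have -> : y + tau - (y' + tau) = y - y' by ring.
  have p0 : 0 <= (2 / 3 : R) ^+ size w by rewrite exprn_ge0 //; lra.
  rewrite ler_pdivrMr ?exprn_gt0 //; move: p0; rewrite expr2.
  by lra.
rewrite /size -/size zE zE' !resolvent_rec -/tau -mulrBr ncM ncV ncM nc_nat nc_beta.
have -> : forall x1 x2 x3 x4 : R[i], x1 + x2 - (x3 + x4) = (x1 - x3) + (x2 - x4).
  by move=> *; ring.
have -> : (2 * (2 / 3))^-1 = 3 / 4 :> R by field.
have := ncD (resolvent (size w) y - resolvent (size w).+1 y')
  (resolvent (size w) (y + tau) - resolvent (size w).+1 (y' + tau)).
by rewrite !exprS; lra.
Qed.

End Construction.

(** * Limits of the Cauchy transforms *)

Section Limits.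
Variable R : realType.
Implicit Types (z p : R[i]) (s t : nat -> bool).

(** Limits are taken along circles around the centres, since the centres
themselves are poles of the approximants. *)
Definition near_point m s z := nc (z - pos R (mkseq s m)) = rad R m.

Lemma near_center m s : near_point m s (pos R (mkseq s m) + (rad R m)%:C%C).
Proof. by rewrite /near_point addrAC subrr add0r nc_real gtr0_norm ?rad_gt0. Qed.

Lemma near_step_seq m s z z' : near_point m s z -> near_point m.+1 s z' ->
  nc (z - z') <= 4 / 3 * (2 / 3) ^+ m.
Proof.
rewrite /near_point mkseqS => h h'.
by have := @near_step R (mkseq s m) (s m) z z'; rewrite size_mkseq; apply.
Qed.

Lemma pow23_34 m : (2 / 3 : R) ^+ m <= (3 / 4) ^+ m.
Proof. by apply: lerXn2r; rewrite ?nnegrE; lra. Qed.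

Lemma pow34_gt0 m : 0 < (3 / 4 : R) ^+ m.
Proof. by rewrite exprn_gt0 //; lra. Qed.

Lemma limit_exists (U : nat -> R[i] -> R[i]) (K B : R) :
    (forall m s z z', near_point m s z -> near_point m.+1 s z' ->
       nc (U m z - U m.+1 z') <= K * (3 / 4) ^+ m) ->
    (forall s z, near_point 0 s z -> nc (U 0%N z) <= B) ->
  exists2 G : (nat -> bool) -> R[i], forall s, nc (G s) <= B + 9 * K &
    forall m s z, near_point m s z -> nc (U m z - G s) <= 9 * K * (3 / 4) ^+ m.
Proof.
move=> HU HB.
have step m s := HU m s _ _ (near_center m s) (near_center m.+1 s).
have K0 : 0 <= K.
  by have := step 0%N (fun=> false); rewrite expr0 mulr1; apply: le_trans (nc_ge0 _).
have H s : exists l, forall m,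
    nc (U m (pos R (mkseq s m) + (rad R m)%:C%C) - l) <= 8 * K * (3 / 4) ^+ m.
  have [||l hl] := @geometric_cauchy R
      (fun m => U m (pos R (mkseq s m) + (rad R m)%:C%C)) K (3 / 4) _ _ (step ^~ s).
  - by lra.
  - by lra.
  exists l => m; apply: le_trans (hl m) _.
  by rewrite le_eqVlt; apply/orP; left; apply/eqP; field.
have [G hG] := choice H.
have near m s z : near_point m s z -> nc (U m z - G s) <= 9 * K * (3 / 4) ^+ m.
  move=> zs; have h1 := HU m s _ _ zs (near_center m.+1 s).
  have h2 := hG s m.+1; move: h1 h2; set y := U m.+1 _ => h1 h2.
  apply: le_trans (nc_triangle y _ _) _.
  have : 0 <= K * (3 / 4) ^+ m by rewrite mulr_ge0 // ltW ?pow34_gt0.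
  by move: h1 h2; rewrite exprS; lra.
exists G => // s; have n0 := near_center 0 s.
have := near _ _ _ n0; have := HB _ _ n0; rewrite expr0 mulr1.
move: (U 0%N _) => y yB; rewrite nc_distC => yG.
by have := nc_sub (G s) y; lra.
Qed.

Lemma mkseq_shift s m : mkseq s m.+1 = s 0%N :: mkseq (shift s) m.
Proof. by rewrite /mkseq /= (iotaDl 1 0) -map_comp. Qed.

Lemma nc_near m s z w : near_point m s z -> nc (z - pos R w) <= 7.
Proof.
rewrite /near_point => h; have := nc_triangle (pos R (mkseq s m)) z (pos R w).
rewrite h; have := rad_le R m; have := ncB (pos R (mkseq s m)) (pos R w).
by have := nc_pos R (mkseq s m); have := nc_pos R w; lra.
Qed.

Lemma nc_near_pt m s z : near_point m s z -> nc z <= 7.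
Proof. by move/(nc_near [::]); rewrite subr0. Qed.

Lemma pos_agree_split k m s t : agree k s t -> s k = true -> t k = false ->
  (k < m)%N -> exists D, [/\ pos R (mkseq s m) - pos R (mkseq t m) = beta R ^+ k * D,
    2 / 5 <= Re D & nc D <= 6].
Proof.
elim: k m s t => [|k IH] [|m] s t // st sk tk km; rewrite !mkseq_shift.
  exists (pos R (true :: mkseq (shift s) m) - pos R (false :: mkseq (shift t) m)).
  rewrite sk tk expr0 mul1r; split=> //; first exact: pos_split.
  apply: le_trans (ncB _ _) _.
  by have := nc_pos R (true :: mkseq (shift s) m);
    have := nc_pos R (false :: mkseq (shift t) m); lra.
have [D [DE D1 D2]] := IH m (shift s) (shift t) (fun i ik => st i.+1 ik) sk tk km.
exists D; split=> //; rewrite (st 0%N) // exprS -mulrA -DE /=; ring.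
Qed.

Variable k : R[i].
Hypothesis nc_k : nc k = 1000.

Lemma far_point z : nc z <= 7 -> 993 <= nc (k + z).
Proof. by move=> z7; have := nc_add k z; rewrite nc_k; lra. Qed.

Lemma near_far m s z w : near_point m s z -> 993 <= nc (z + k - pos R w).
Proof.
move=> /(nc_near w) /far_point.
by rewrite addrA (addrC k).
Qed.

Lemma resolvent_far_step m s z z' : near_point m s z -> near_point m.+1 s z' ->
  nc (resolvent m (z + k) - resolvent m.+1 (z' + k)) <= 3 * (3 / 4) ^+ m.
Proof.
move=> zs zs'; have one : 0 < 1 :> R by [].
apply: le_trans (resolvent_regular m one _ _) _ => [w|w|].
- have := near_far w zs. lra.
- by have := near_far w zs'; lra.
have -> : z + k - (z' + k) = z - z' by ring.
rewrite expr1n divr1; have := near_step_seq zs zs'; have := pow23_34 m.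
by have := pow34_gt0 m; lra.
Qed.

(** Seen from the distance |k| = 1000 the measure is nearly a unit mass at 0. *)
Lemma resolvent_far_near m s z : near_point m s z ->
  nc (k * resolvent m (z + k) - 1) <= 50^-1.
Proof.
move=> zs; rewrite /resolvent -avgM; apply: nc_avg_near => v _.
have z7 := nc_near v zs; have h := far_point z7.
have -> : z + k - pos R v = k + (z - pos R v) by ring.
move: (z - pos R v) z7 h => x z7 h.
have kx : k + x != 0 by rewrite -nc_gt0; lra.
have -> : k / (k + x) - 1 = - x / (k + x) by field.
rewrite ncM ncN ncV ler_pdivrMr; lra.
Qed.

Variable G : (nat -> bool) -> R[i].
Variable K : R.
Hypothesis G_near : forall m s z, near_point m s z ->
  nc (resolvent m (z + k) - G s) <= K * (3 / 4) ^+ m.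

Lemma pow34_small (L e : R) : 0 < e ->
  exists m, forall n, (m <= n)%N -> L * (3 / 4) ^+ n <= e.
Proof. by apply: geometric_small; lra. Qed.

Lemma far_limit_lb s : 2000^-1 <= nc (G s).
Proof.
have [|m hm] := @pow34_small K (10000^-1); first by lra.
have := G_near (near_center m s); have := resolvent_far_near (near_center m s).
move: (resolvent m _) => y h1 h2; have := hm m (leqnn m).
have := nc_sub y (G s); have := nc_sub 1 (k * y).
by rewrite nc1 ncM nc_k (nc_distC 1); lra.
Qed.

(** On the far copy the resolvent is nearly the affine map
z |-> 1 / k - z / k ^ 2, with derivative uniformly close to - 1 / k ^ 2, so it
keeps apart what the real and imaginary parts of z keep apart. *)
Lemma far_limit_separating : separating G.
Proof.
have k0 : k != 0 by rewrite -nc_gt0 nc_k; lra.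
have b0 := beta_neq0 R.
move=> j; pose u := - k ^+ 2 / beta R ^+ j.
exists u, 4^-1; first by lra.
move=> s t st sj tj.
have [|m0 hm] := @pow34_small (nc u * (2 * K)) (100^-1); first by lra.
pose m := maxn m0 j.+1.
have {}hm := hm m (leq_maxl _ _).
have jm : (j < m)%N by rewrite leq_max leqnn orbT.
have [D [DE D1 D2]] := pos_agree_split st sj tj jm.
pose z := pos R (mkseq s m) + (rad R m)%:C%C.
pose z' := pos R (mkseq t m) + (rad R m)%:C%C.
have zs : near_point m s z by apply: near_center.
have zt : near_point m t z' by apply: near_center.
have zz : z - z' = beta R ^+ j * D by rewrite -DE /z /z'; ring.
have main : nc (u * (resolvent m (z + k) - resolvent m (z' + k)) - D) <= 7 / 50.
  rewrite /resolvent -avgB -avgM; apply: nc_avg_near => v _.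
  have x7 := nc_near v zs; have y7 := nc_near v zt.
  have hx := far_point x7; have hy := far_point y7.
  have -> : z + k - pos R v = k + (z - pos R v) by ring.
  have -> : z' + k - pos R v = k + (z' - pos R v) by ring.
  have xy : (z - pos R v) - (z' - pos R v) = beta R ^+ j * D by rewrite -zz; ring.
  move: (z - pos R v) (z' - pos R v) x7 y7 hx hy xy => x y x7 y7 hx hy xy.
  have kx : k + x != 0 by rewrite -nc_gt0; lra.
  have ky : k + y != 0 by rewrite -nc_gt0; lra.
  have -> : u * ((k + x)^-1 - (k + y)^-1) - D =
      - (D * ((k * (x + y) + x * y) / ((k + x) * (k + y)))).
    have -> : (k + x)^-1 - (k + y)^-1 = - (x - y) / ((k + x) * (k + y)).
      by field; rewrite kx ky.
    rewrite xy /u; field; rewrite ?kx ?ky ?expf_neq0 //.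
  rewrite ncN ncM.
  have h : nc ((k * (x + y) + x * y) / ((k + x) * (k + y))) <= 50^-1.
    rewrite ncM ncV ncM ler_pdivrMr ?mulr_gt0; try lra.
    apply: le_trans (ncD _ _) _; rewrite !ncM nc_k.
    have := ncD x y; have : nc x * nc y <= 7 * 7 by apply: ler_pM; rewrite ?nc_ge0.
    have : 993 * 993 <= nc (k + x) * nc (k + y) by apply: ler_pM; lra.
    lra.
  apply: (@le_trans _ _ (6 * 50^-1)); last by lra.
  by apply: ler_pM; rewrite ?nc_ge0.
have hs := G_near zs; have ht := G_near zt.
move: main hs ht; set a := resolvent m (z + k); set b := resolvent m (z' + k).
move=> main hs ht.
have err : nc (u * (G s - G t) - u * (a - b)) <= 100^-1.
  have -> : u * (G s - G t) - u * (a - b) = u * ((b - G t) - (a - G s)) by ring.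
  rewrite ncM; apply: le_trans hm; rewrite -mulrA; apply: ler_wpM2l.
    exact: nc_ge0.
  by have := ncB (b - G t) (a - G s); lra.
have e1 := le_trans (Re_le_nc _) err; have e2 := le_trans (Re_le_nc _) main.
by move: e1 e2; rewrite !(ReB (u * _)) !ler_norml; lra.
Qed.

End Limits.

(** * Two distant copies in three variables *)

Section TwoCopies.
Variable R : realType.
Implicit Types (z : R[i]) (s t : nat -> bool).

Definition shift_to (b : bool) : R[i] := if b then 1000 else 0.

Definition center (w : seq bool) : R[i] :=
  shift_to (head false w) + pos R (behead w).

Definition words m : seq (seq bool) := [seq val tw | tw <- enum {: m.-tuple bool}].

Definition centers m := [seq center w | w <- words m.+1].

Lemma mem_words m w : (w \in words m) = (size w == m).
Proof.
apply/mapP/idP => [[tw _ ->]|wm]; first by rewrite size_tuple.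
by exists (Tuple wm); rewrite ?mem_enum.
Qed.

Lemma center_sep w w' : size w = size w' -> w != w' ->
  2 * rad R (size w).-1 < nc (center w - center w').
Proof.
case: w w' => [|b v] [|c v'] //= [] vv; rewrite /center /=.
have r5 := rad_le R (size v).
have far (p : R[i]) : nc p <= 6 -> 2 * rad R (size v) < nc (1000 + p).
  by move=> p6; have := nc_add 1000 p; rewrite nc_nat; lra.
have p6 : nc (pos R v - pos R v') <= 6.
  by have := ncB (pos R v) (pos R v'); have := nc_pos R v; have := nc_pos R v'; lra.
have [<-|bc _] := eqVneq b c.
  rewrite eqseq_cons eqxx /= => vv'.
  by rewrite opprD addrACA subrr add0r; apply: pos_sep.
rewrite /shift_to; case: b c bc => [] [] // _.
  have -> : 1000 + pos R v - (0 + pos R v') = 1000 + (pos R v - pos R v') by ring.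
  exact: far.
have -> : 0 + pos R v - (1000 + pos R v') = - (1000 + (pos R v' - pos R v)) by ring.
by rewrite ncN; apply: far; rewrite nc_distC.
Qed.

Lemma center_inj w w' : size w = size w' -> center w = center w' -> w = w'.
Proof.
move=> ww cw; apply/eqP; apply: contraT => /(center_sep ww).
by rewrite cw subrr nc0; have := rad_gt0 R (size w).-1; lra.
Qed.

Lemma centers_uniq m : uniq (centers m).
Proof.
have uw : uniq (words m.+1) by rewrite (map_inj_uniq val_inj) enum_uniq.
rewrite map_inj_in_uniq //.
by move=> w w'; rewrite !mem_words => /eqP wm /eqP wm'; apply: center_inj; rewrite wm.
Qed.

Lemma centers_sep m a b : a \in centers m -> b \in centers m -> a != b ->
  2 * rad R m < nc (a - b).
Proof.
move=> /mapP[w + ->] /mapP[w' + ->]; rewrite !mem_words => /eqP wm /eqP wm' ww.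
have := @center_sep w w'; rewrite wm wm'; apply=> //.
by apply: contraNneq ww => ->.
Qed.

Definition point_center m s := center (mkseq s m.+1).

Lemma point_centerE m s :
  point_center m s = shift_to (s 0%N) + pos R (mkseq (shift s) m).
Proof. by rewrite /point_center mkseq_shift. Qed.

Lemma centers_point m c : c \in centers m -> exists s, point_center m s = c.
Proof.
move=> /mapP[w]; rewrite mem_words => /eqP wm ->; exists (nth false w).
by rewrite /point_center -wm mkseq_nth.
Qed.

Lemma point_center_agree m s t : agree m.+1 s t ->
  point_center m s = point_center m t.
Proof.
move=> st; congr center; apply/eq_in_map => i.
by rewrite mem_iota /= => /st.
Qed.

Lemma near_shift m s z : nc (z - point_center m s) = rad R m ->
  near_point m (shift s) (z - shift_to (s 0%N)).
Proof. by rewrite point_centerE /near_point opprD addrA. Qed.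

Definition cons_seq (b : bool) s i := if i is j.+1 then s j else b.

Lemma cons_seqE s : cons_seq (s 0%N) (shift s) = s.
Proof. by apply/funext => -[|i]. Qed.

Lemma agree_cons m s t : s 0%N = t 0%N -> agree m (shift s) (shift t) ->
  agree m.+1 s t.
Proof. by move=> st0 st [|i] // /st. Qed.

(** The Cauchy transforms of the two copies and z times the first one, at level
m; their values at infinity are the coordinates of hull_point. *)
Definition level_map (i : 'I_3) m z : R[i] :=
  [:: resolvent m z; resolvent m (z - 1000); z * resolvent m z]`_i.

Definition hull_point : 'rV[R[i]]_3 := \row_i [:: 0; 0; 1]`_i.

Lemma fraction_at_level m i :
  fraction_at (\prod_(a <- centers m) ('X - a%:P)) (level_map i m)
    (hull_point ord0 i).
Proof.
have mD := monic_prod_XsubC (centers m) xpredT id.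
set D := \prod_(_ <- _) _ in mD *.
have cin b v : size v = m -> shift_to b + pos R v \in centers m.
  by move=> vm; apply/mapP; exists (b :: v); rewrite ?mem_words //= vm.
have inv0 v : size v = m -> fraction_at D (fun z => (z - pos R v)^-1) 0.
  by move=> vm; have := fraction_at_inv (cin false v vm); rewrite add0r.
rewrite mxE; case: i => [[|[|[|//]]] lti] /=.
- exact: (fraction_at_avg mD inv0).
- apply: (fraction_at_avg (F := fun v z => (z - 1000 - pos R v)^-1) mD) => v vm.
  apply: fraction_at_ext (fraction_at_inv (cin true v vm)) => z _.
  by rewrite opprD addrA.
apply: (@fraction_at_ext _ _ (fun z => avg m (fun v => z * (z - pos R v)^-1))).
  by move=> z _; rewrite avgM.
apply: (fraction_at_avg (F := fun v z => z * (z - pos R v)^-1) mD) => v vm.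
(* z / (z - p) = 1 + p / (z - p) has value 1 at infinity. *)
have := fraction_atD mD (fraction_at_cst D 1)
  (fraction_atM mD (fraction_at_cst D (pos R v)) (inv0 v vm)).
rewrite mulr0 addr0; apply: fraction_at_ext => z.
rewrite horner_prodXsub prodf_seq_neq0 => /allP /(_ _ (cin false v vm)) /=.
by rewrite add0r => zv; field.
Qed.

End TwoCopies.

(** The limits of the transforms on the set itself and on its translates by 1000
and - 1000, and of the centres. *)
Section Assembly.
Variable R : realType.
Variables (res_self res_plus res_minus pt : (nat -> bool) -> R[i]) (K : R).
Hypothesis res_self_le : forall s, nc (res_self s) <= K.
Hypothesis res_plus_le : forall s, nc (res_plus s) <= K.
Hypothesis res_minus_le : forall s, nc (res_minus s) <= K.
Hypothesis res_self_near : forall m s z, near_point m s z ->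
  nc (resolvent m z - res_self s) <= K * (3 / 4) ^+ m.
Hypothesis res_plus_near : forall m s z, near_point m s z ->
  nc (resolvent m (z + 1000) - res_plus s) <= K * (3 / 4) ^+ m.
Hypothesis res_minus_near : forall m s z, near_point m s z ->
  nc (resolvent m (z - 1000) - res_minus s) <= K * (3 / 4) ^+ m.
Hypothesis pt_near : forall m s z, near_point m s z ->
  nc (z - pt s) <= K * (3 / 4) ^+ m.

(** The first bit selects the copy. On the copy around 0 the second coordinate is
the transform of the other, distant, copy; on the copy around 1000 the first
one is. *)
Definition limit_map s : 'rV[R[i]]_3 :=
  let: X := shift_to R (s 0%N) + pt (shift s) in
  let: f := if s 0%N then res_plus (shift s) else res_self (shift s) in
  let: g := if s 0%N then res_self (shift s) else res_minus (shift s) in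
  \row_i [:: f; g; X * f]`_i.

Lemma nc_1000 : nc (1000 : R[i]) = 1000. Proof. exact: nc_nat. Qed.
Lemma nc_N1000 : nc (- 1000 : R[i]) = 1000. Proof. by rewrite ncN nc_1000. Qed.

Lemma nc_shift_to b : nc (shift_to R b) <= 1000.
Proof. by case: b; [rewrite nc_1000 lexx | rewrite nc0; lra]. Qed.

Lemma K_ge0 : 0 <= K.
Proof. by apply: le_trans (res_self_le (fun=> false)); apply: nc_ge0. Qed.

Lemma pt_le s : nc (pt s) <= 8.
Proof.
have [|m /(_ m (leqnn m)) hm] := @pow34_small R K 1; first by [].
have := pt_near (near_center R m s); have := nc_near_pt (near_center R m s).
by move: (pos R _ + _) => z z7; rewrite nc_distC; have := nc_sub (pt s) z; lra.
Qed.

Lemma level_map_cvg (i : 'I_3) m s z :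
  nc (z - point_center R m s) = rad R m ->
  nc (level_map i m z - limit_map s ord0 i) <= (1008 * K + K * (2 * K)) * (3 / 4) ^+ m.
Proof.
move=> /near_shift zs; have K0 := K_ge0; have q0 := pow34_gt0 R m.
have q1 : (3 / 4 : R) ^+ m <= 1 by rewrite exprn_ile1 //; lra.
have Kq : K * (3 / 4) ^+ m <= (1008 * K + K * (2 * K)) * (3 / 4) ^+ m.
  by apply: ler_wpM2r; [exact: ltW | nra].
set y := z - shift_to R (s 0%N) in zs; have zE : z = y + shift_to R (s 0%N).
  by rewrite /y subrK.
pose f := if s 0%N then res_plus (shift s) else res_self (shift s).
have hf : nc (resolvent m z - f) <= K * (3 / 4) ^+ m.
  rewrite zE /f /shift_to; case: (s 0%N); first exact: res_plus_near.
  by rewrite addr0; apply: res_self_near.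
have fK : nc f <= K by rewrite /f; case: ifP.
rewrite mxE /level_map; case: i => [[|[|[|//]]] lti] /=; rewrite -/f.
- exact: le_trans Kq.
- apply: le_trans Kq; case: (s 0%N) zE => /= ->.
    by rewrite addrK; apply: res_self_near.
  by rewrite addr0; apply: res_minus_near.
set X := shift_to R (s 0%N) + pt (shift s).
have zX : nc (z - X) <= K * (3 / 4) ^+ m.
  have -> : z - X = y - pt (shift s) by rewrite zE /X; ring.
  exact: pt_near.
have X8 : nc X <= 1008.
  apply: le_trans (ncD _ _) _; have := pt_le (shift s).
  by have := nc_shift_to (s 0%N); lra.
have -> : z * resolvent m z - X * f =
    X * (resolvent m z - f) + (z - X) * resolvent m z by ring.
apply: le_trans (ncD _ _) _; rewrite !ncM mulrDl; apply: lerD.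
  by rewrite -mulrA; apply: ler_pM; rewrite ?nc_ge0.
rewrite mulrAC; apply: ler_pM; rewrite ?nc_ge0 //.
have := nc_sub (resolvent m z) f; have : K * (3 / 4) ^+ m <= K by rewrite ler_piMr.
lra.
Qed.

Lemma limit_map_tracked i :
  tracked (centers R) (point_center R) (rad R) (level_map i)
    (fun s => limit_map s ord0 i) (hull_point R ord0 i).
Proof.
split; last by move=> m; apply: fraction_at_level.
- exists (K + 1008 * K) => s; have K0 := K_ge0.
  have fK : nc (if s 0%N then res_plus (shift s) else res_self (shift s)) <= K.
    by case: ifP.
  have gK : nc (if s 0%N then res_self (shift s) else res_minus (shift s)) <= K.
    by case: ifP.
  rewrite mxE; case: i => [[|[|[|//]]] lti] /=; [lra|lra|].
  suff : nc ((shift_to R (s 0%N) + pt (shift s)) *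
     (if s 0%N then res_plus (shift s) else res_self (shift s))) <= 1008 * K by lra.
  rewrite ncM; apply: ler_pM; rewrite ?nc_ge0 //.
  apply: le_trans (ncD _ _) _; have := pt_le (shift s).
  by have := nc_shift_to (s 0%N); lra.
move=> e e0.
have [m0 hm] := @pow34_small R (1008 * K + K * (2 * K)) e e0.
by exists m0 => m /hm h s z zs; apply: le_trans (level_map_cvg i zs) h.
Qed.

Lemma limit_map_ucont i : ucont (fun s => limit_map s ord0 i).
Proof.
exact: (tracked_ucont (rad_gt0 R) (@point_center_agree R) (limit_map_tracked i)).
Qed.

Lemma limit_map_hull : rational_hull (range limit_map) (hull_point R).
Proof.
apply: (tracked_rational_hull (rad_gt0 R) (@centers_uniq R) _ (@centers_sep R)
  (@centers_point R) (@point_center_agree R) limit_map_tracked).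
move=> m; rewrite size_map size_map -cardE card_tuple card_bool.
by rewrite expn_gt0.
Qed.

Lemma res_plus_lb s : 2000^-1 <= nc (res_plus s).
Proof. exact: (far_limit_lb nc_1000 res_plus_near s). Qed.

Lemma res_minus_lb s : 2000^-1 <= nc (res_minus s).
Proof. exact: (far_limit_lb nc_N1000 res_minus_near s). Qed.

Lemma hull_point_notin : ~ range limit_map (hull_point R).
Proof.
move=> [s _ /rowP sE].
have := sE (inord 0); have := sE (inord 1).
rewrite !mxE !inordK //; case: (s 0%N) => /= [_ f0|f0 _].
  by have := res_plus_lb (shift s); rewrite f0 nc0; lra.
by have := res_minus_lb (shift s); rewrite f0 nc0; lra.
Qed.

Lemma limit_map_true_separating :
  separating (fun s => limit_map (cons_seq true s) ord0 (inord 0)).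
Proof.
have := far_limit_separating nc_1000 res_plus_near.
by congr separating; apply/funext => s; rewrite mxE inordK.
Qed.

Lemma limit_map_false_separating :
  separating (fun s => limit_map (cons_seq false s) ord0 (inord 1)).
Proof.
have := far_limit_separating nc_N1000 res_minus_near.
by congr separating; apply/funext => s; rewrite mxE inordK.
Qed.

(** If the first coordinates were both f and the third ones equal, then z f = z' f
for points z and z' of the two copies; but f, being the value of the transform
of a distant copy, does not vanish. *)
Lemma limit_map_cross s t : s 0%N = false -> t 0%N = true ->
  ~ forall i, nc (limit_map s ord0 i - limit_map t ord0 i) < 50^-1.
Proof.
move=> s0 t0 H; have := H (inord 0); have := H (inord 2).
rewrite !mxE !inordK //= s0 t0 /shift_to add0r.
have := res_plus_lb (shift t); have := pt_le (shift s); have := pt_le (shift t).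
move: (res_plus _) (res_self _) (pt (shift s)) (pt (shift t)) => f g X Y Y8 X8 f1 h1 h2.
have : nc ((1000 + (Y - X)) * f) <= 50^-1 + 8 * 50^-1.
  have -> : (1000 + (Y - X)) * f = - (X * g - (1000 + Y) * f) + X * (g - f) by ring.
  apply: le_trans (ncD _ _) _; rewrite ncN ncM; apply: lerD; first exact: ltW.
  by apply: ler_pM; rewrite ?nc_ge0 // ltW.
rewrite ncM => h3.
have h4 : 984 <= nc (1000 + (Y - X)).
  by have := nc_add 1000 (Y - X); have := ncB Y X; rewrite nc_1000; lra.
have : 984 * 2000^-1 <= nc (1000 + (Y - X)) * nc f by apply: ler_pM; lra.
lra.
Qed.

Lemma limit_map_injective m : exists2 d : R, 0 < d & forall s t,
  (forall i, nc (limit_map s ord0 i - limit_map t ord0 i) < d) -> agree m s t.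
Proof.
have [d d0 hd] := separating_injective limit_map_true_separating m.
have [e e0 he] := separating_injective limit_map_false_separating m.
exists (Num.min d (Num.min e 50^-1)) => [|s t H].
  by rewrite !lt_min d0 e0; lra.
have {}H i : [/\ nc (limit_map s ord0 i - limit_map t ord0 i) < d,
    nc (limit_map s ord0 i - limit_map t ord0 i) < e &
    nc (limit_map s ord0 i - limit_map t ord0 i) < 50^-1].
  by have := H i; rewrite !lt_min => /andP[? /andP[]].
case s0: (s 0%N); case t0: (t 0%N).
- apply: (@agreeW m m.+1) => //; apply: agree_cons; first by rewrite s0.
  apply: hd; have [+ _ _] := H (inord 0).
  by rewrite -{1}(cons_seqE s) -{1}(cons_seqE t) s0 t0.
- case: (@limit_map_cross t s t0 s0) => i.
  by rewrite nc_distC; case: (H i).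
- by case: (@limit_map_cross s t s0 t0) => i; case: (H i).
apply: (@agreeW m m.+1) => //; apply: agree_cons; first by rewrite s0.
apply: he; have [_ + _] := H (inord 1).
by rewrite -{1}(cons_seqE s) -{1}(cons_seqE t) s0 t0.
Qed.

Lemma ucont_cons b (G : (nat -> bool) -> R[i]) :
  ucont G -> ucont (fun s => G (cons_seq b s)).
Proof.
move=> cG e /cG [m hm]; exists m => s t st; apply: hm.
by move=> [|i] //= im; apply: st; apply: ltnW.
Qed.

Lemma half_cantor b : is_cantor_set R (range (limit_map \o cons_seq b)).
Proof.
apply: is_cantor_set_range => [i|m]; first exact: (ucont_cons b (limit_map_ucont i)).
have [d d0 hd] := limit_map_injective m.+1; exists d => // s t /hd st i im.
exact: (st i.+1 im).
Qed.

Lemma half_polynomially_convex b :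
  polynomially_convex (range (limit_map \o cons_seq b)).
Proof.
have cb i := ucont_cons b (limit_map_ucont i).
have bb i : exists B, forall s, nc ((limit_map \o cons_seq b) s ord0 i) <= B.
  by have [[B hB] _ _] := limit_map_tracked i; exists B => s; apply: hB.
case: b cb bb => cb bb.
  exact: (polynomially_convex_separating cb bb limit_map_true_separating).
exact: (polynomially_convex_separating cb bb limit_map_false_separating).
Qed.

Lemma cantor_union : exists X : set 'rV[R[i]]_3,
    [/\ is_cantor_set R X,
        nontrivial_rational_hull X &
        exists A B : set 'rV[R[i]]_3,
          [/\ is_cantor_set R A /\ polynomially_convex A,
              is_cantor_set R B /\ polynomially_convex B,
              A `&` B = set0 &
              X = A `|` B]].
Proof.
exists (range limit_map); split.
- by apply: is_cantor_set_range; [exact: limit_map_ucont | exact: limit_map_injective].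
- by exists (hull_point R); split; [exact: limit_map_hull | exact: hull_point_notin].
exists (range (limit_map \o cons_seq false)), (range (limit_map \o cons_seq true)).
split.
- by split; [exact: half_cantor | exact: half_polynomially_convex].
- by split; [exact: half_cantor | exact: half_polynomially_convex].
- apply/seteqP; split => // z [[s _ <-] [t _ /= ts]].
  apply: (@limit_map_cross (cons_seq false s) (cons_seq true t)) => // i.
  by rewrite ts subrr nc0; lra.
apply/seteqP; split => [_ [s _ <-]|_ [[s _ <-]|[s _ <-]]].
- rewrite -(cons_seqE s); case: (s 0%N); [right|left]; by exists (shift s).
- by exists (cons_seq false s).
- by exists (cons_seq true s).
Qed.

End Assembly.

Section Existence.
Variable R : realType.

Lemma resolvent_self_step m s (z z' : R[i]) :
  near_point m s z -> near_point m.+1 s z' ->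
  nc (resolvent m z - resolvent m.+1 z') <= 145 * (3 / 4) ^+ m.
Proof.
rewrite /near_point mkseqS => h h'.
have := @resolvent_self R (mkseq s m) (s m) z z'; rewrite size_mkseq => H.
have : 0 <= (2 / 3 : R) ^+ m by rewrite exprn_ge0 //; lra.
by have := H h h'; lra.
Qed.

Lemma far_limit_exists (k : R[i]) : nc k = 1000 ->
  exists2 G : (nat -> bool) -> R[i], forall s, nc (G s) <= 1310 &
    forall m s z, near_point m s z ->
      nc (resolvent m (z + k) - G s) <= 1310 * (3 / 4) ^+ m.
Proof.
move=> nk; have [||G G_le G_near] :=
  @limit_exists R (fun m z => resolvent m (z + k)) 3 1.
- by move=> m s z z'; apply: resolvent_far_step.
- move=> s z zs; rewrite /resolvent /= ncV invf_le1.
    by have := near_far nk [::] zs; rewrite /=; lra.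
  by have := near_far nk [::] zs; rewrite /=; lra.
exists G => [s|m s z zs]; first by have := G_le s; lra.
by have := G_near m s z zs; have := pow34_gt0 R m; lra.
Qed.

End Existence.

Unset Implicit Arguments.

Theorem corollary3p5 (R : realType) :
  exists X : set 'rV[R[i]]_3,
    [/\ is_cantor_set R X,
        nontrivial_rational_hull X &
        exists A B : set 'rV[R[i]]_3,
          [/\ is_cantor_set R A /\ polynomially_convex A,
              is_cantor_set R B /\ polynomially_convex B,
              A `&` B = set0 &
              X = A `|` B]].
Proof.
have [||res_self res_self_le res_self_near] := @limit_exists R (@resolvent R) 145 5.
- exact: resolvent_self_step.
- move=> s z; rewrite /near_point /rad expr0 mulr1 => zs.
  by rewrite /resolvent /avg ncV zs invrK.
have [||pt _ pt_near] := @limit_exists R (fun _ z => z) 2 7.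
- move=> m s z z' h h'; have := near_step_seq h h'; have := pow23_34 R m.
  by have := pow34_gt0 R m; lra.
- by move=> s z /nc_near_pt.
have [res_plus res_plus_le res_plus_near] := far_limit_exists (nc_1000 R).
have [res_minus res_minus_le res_minus_near] := far_limit_exists (nc_N1000 R).
(* 1310 = 5 + 9 * 145 is the bound that limit_exists gives near the set itself. *)
apply: (@cantor_union R res_self res_plus res_minus pt 1310) => //.
- by move=> s; have := res_self_le s; lra.
- by move=> m s z /res_self_near; have := pow34_gt0 R m; lra.
- by move=> m s z /pt_near; have := pow34_gt0 R m; lra.
Qed.
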